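(* Let $L\in(0,\infty]$, $\Omega=(-L,L)$, $\mathsf a>0$, $u_\infty\in\mathbb R$, and $\bar w\in L^2(\Omega)$. For $\nu\in L^2(\Omega)$ define $$\mathfrak S[\nu]=\inf_{w\in L^2(\Omega)}\int_{-L}^{L}\Big(\tfrac{w^2}{2}(\mathsf a+K\nu)+w\,(\nu+u_\infty K\nu-\mathsf a\bar w)\Big)\,dx .$$ Then the following hold. (1) $\mathfrak S$ is given by $$\mathfrak S[\nu]=\int_{-L}^{L}\Big(-\tfrac12(\mathsf a+K\nu)\hat w^2\Big)dx\ \text{ if } |N_\nu|=0 \text{ and } |Z_\nu|=0,\qquad \mathfrak S[\nu]=-\infty\ \text{ if } |N_\nu|>0 \text{ or } |Z_\nu|>0,$$ and $\mathfrak S$ maps $L^2(\Omega)$ into $[-\infty,0]$. (2) $\mathfrak S$ is concave and upper semicontinuous on $L^2(\Omega)$. (3) The interior (in $L^2(\Omega)$) of its domain $\operatorname{dom}\mathfrak S=\{\nu\in L^2(\Omega):\mathfrak S[\nu]>-\infty\}$ is $$\operatorname{int}\operatorname{dom}\mathfrak S=\{\nu\in L^2(\Omega):\ \mathsf a+K\nu(x)>0\ \text{ for all } x\in\mathbb R\}.$$ (4) If additionally $-\mathfrak S$ is coercive, then a maximizer of $\mathfrak S$ exists. (5) If $\mathfrak S$ has some maximizer $\nu\in\operatorname{int}\operatorname{dom}\mathfrak S$, then the function $\hat w$ is a $C^\infty$ solution of $$w+u_\infty Kw+\tfrac12K(w^2)=0 .$$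
   Context: All functions are real-valued. The operator $K$ is $$K\nu(x)=\int_{x-1}^{x+1}\nu(y)\,dy .$$ If $L=\infty$ this is applied directly to functions on $\Omega=\mathbb R$. If $0<L<\infty$, functions on $\Omega$ are first extended $2L$-periodically to $\mathbb R$; $K\nu$ is then a continuous $2L$-periodic function on $\mathbb R$, restricted to $\Omega$ when regarded as a function on $\Omega$. In either case $K$ is a bounded linear operator from $L^2(\Omega)$ into $H^1(\Omega)$, and the same formula defines $K(w^2)$ for $w\in L^2(\Omega)$. For $\nu\in L^2(\Omega)$, with $|\cdot|$ denoting Lebesgue measure, $$N_\nu=\{x\in(-L,L):\mathsf a+K\nu<0\},\qquad Z_\nu=\{x\in(-L,L):\mathsf a+K\nu=0\ \text{and}\ \mathsf a\bar w-\nu-u_\infty K\nu\ne0\},$$ and $$\hat w=\begin{cases}\dfrac{\mathsf a\bar w-\nu-u_\infty K\nu}{\mathsf a+K\nu}&\text{if }\mathsf a+K\nu\ne0,\\[2mm] 0&\text{if }\mathsf a+K\nu=0.\end{cases}$$ Coercivity of $-\mathfrak S$ means $-\mathfrak S[\nu]\to\infty$ as $\|\nu\|_{L^2(\Omega)}\to\infty$. In (5), $\hat w$ is regarded as a function on $\mathbb R$ ($2L$-periodic if $L<\infty$), up to modification on a null set, and the equation holds on $\mathbb R$. *)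

(* Defs.v *)
From HB Require Import structures.
From mathcomp Require Import all_boot all_order all_algebra.
From mathcomp Require Import all_classical all_reals all_analysis.

Set Implicit Arguments.
Unset Strict Implicit.
Unset Printing Implicit Defensive.

Import Order.TTheory GRing.Theory Num.Theory.
Import numFieldNormedType.Exports.

Local Open Scope classical_set_scope.
Local Open Scope ring_scope.

Definition Omega {R : realType} (L : \bar R) : set (measurableTypeR R) :=
  [set x | - L < x%:E < L]%E.

Lemma measurable_Omega {R : realType} (L : \bar R) : measurable (Omega L).
Proof.
case: L => [r||].
- have -> : Omega r%:E = `]- r, r[%classic; last exact: measurable_itv.
  by apply/seteqP; split=> x; rewrite /Omega/= in_itv/= !lte_fin.
- have -> : Omega +oo%E = setT :> set (measurableTypeR R); last exact: measurableT.
  by apply/seteqP; split=> x //= _; rewrite /Omega/= ltNyr ltry.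
- have -> : Omega -oo%E = set0 :> set (measurableTypeR R); last exact: measurable0.
  by apply/seteqP; split=> x //=; rewrite /Omega/= [(_ < -oo)%E]ltNge leNye andbF.
Qed.

(* L^2(Omega): Borel functions on the line that are square integrable for
   Lebesgue measure restricted to Omega. Elements are representatives rather
   than a.e.-classes, and their values off Omega are irrelevant: the L^2-norm
   below is a seminorm, and the topology is the one it induces. *)
Definition L2 {R : realType} (L : \bar R) : Type :=
  LfunType (mrestr (@lebesgue_measure R) (measurable_Omega L)) (lee1n 2).

HB.instance Definition _ (R : realType) (L : \bar R) := GRing.Lmodule.on (@L2 R L).

Definition L2val {R : realType} {L : \bar R} (f : L2 L) : R -> R :=
  (f : LfunType (mrestr (@lebesgue_measure R) (measurable_Omega L)) (lee1n 2)).
Coercion L2val : L2 >-> Funclass.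

Definition L2norm {R : realType} {L : \bar R} (f : L2 L) : R :=
  fine ('N[mrestr (@lebesgue_measure R) (measurable_Omega L)]_2%:E[EFin \o f])%E.

Section L2_topology.
Context {R : realType} {L : \bar R}.
Implicit Types f g h : L2 L.

Lemma L2normD f g : L2norm (f + g) <= L2norm f + L2norm g.
Proof. exact: ler_LnormD. Qed.

Lemma L2normN f : L2norm (- f) = L2norm f.
Proof. exact: LnormrN. Qed.

Lemma L2normMn f n : L2norm (f *+ n) = L2norm f *+ n.
Proof. exact: Lnormr_natmul. Qed.

Lemma L2norm0 : L2norm (0 : L2 L) = 0.
Proof. by rewrite -(mulr0n (0 : L2 L)) L2normMn mulr0n. Qed.

HB.instance Definition _ :=
  @Num.Zmodule_isSemiNormed.Build R (L2 L) L2norm L2normD L2normMn L2normN.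

HB.instance Definition _ := hasNbhs.Build (L2 L) (nbhs_ball_ (ball_ (@L2norm R L))).

Lemma L2_nbhsE :
  @nbhs (L2 L) (L2 L) = nbhs_ (entourage_ (ball_ (@L2norm R L))).
Proof.
apply/funext => f; rewrite predeqE => A; split.
- move=> [e egt0 sbeA].
  exists [set xy | ball_ (@L2norm R L) xy.1 e xy.2]; first by exists e.
  by move=> g /xsectionP; exact: sbeA.
- move=> [E [e egt0 sbeE] sEA].
  by exists e => // g fg; apply: sEA; apply/xsectionP; exact: sbeE.
Qed.

Lemma L2_ball_center f (e : R) : 0 < e -> ball_ (@L2norm R L) f e f.
Proof. by move=> e0; rewrite /ball_/= subrr L2norm0. Qed.

Lemma L2_ball_sym f g (e : R) :
  ball_ (@L2norm R L) f e g -> ball_ (@L2norm R L) g e f.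
Proof. by rewrite /ball_/= -opprB L2normN. Qed.

Lemma L2_ball_triangle f g h (e1 e2 : R) :
  ball_ (@L2norm R L) f e1 g -> ball_ (@L2norm R L) g e2 h ->
  ball_ (@L2norm R L) f (e1 + e2) h.
Proof.
rewrite /ball_/= => fg gh.
by rewrite -(subrKA g) (le_lt_trans (L2normD _ _))// ltrD.
Qed.

HB.instance Definition _ := @Nbhs_isPseudoMetric.Build R (L2 L)
  (entourage_ (ball_ (@L2norm R L))) L2_nbhsE (ball_ (@L2norm R L))
  L2_ball_center L2_ball_sym L2_ball_triangle erefl.

End L2_topology.

(* If L = r%:E with 0 < r, the argument of f is the translate of y by a multiple
   of 2 * r lying in `[-r, r[. *)
Definition periodic_ext {R : realType} (L : \bar R) (f : R -> R) (y : R) : R :=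
  if L is r%:E then f (y - 2 * r * (Num.floor ((y + r) / (2 * r)))%:~R)
  else f y.

Definition Kop {R : realType} (L : \bar R) (f : R -> R) (x : R) : R :=
  \int[lebesgue_measure]_(y in `[x - 1, x + 1]) periodic_ext L f y.

Section dual_functional.
Context {R : realType} {L : \bar R} (a u : R) (wbar : L2 L).
Implicit Types nu w : L2 L.

Definition dual_integral nu w : \bar R :=
  (\int[lebesgue_measure]_(x in Omega L)
    (w x ^+ 2 / 2 * (a + Kop L nu x)
      + w x * (nu x + u * Kop L nu x - a * wbar x))%:E)%E.

Definition frakS nu : \bar R := ereal_inf (range (dual_integral nu)).

Definition Nset nu : set (measurableTypeR R) := [set x | Omega L x /\ a + Kop L nu x < 0].

Definition Zset nu : set (measurableTypeR R) :=
  [set x | [/\ Omega L x, a + Kop L nu x = 0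
             & a * wbar x - nu x - u * Kop L nu x != 0]].

Definition what nu (x : R) : R :=
  if a + Kop L nu x != 0 then
    (a * wbar x - nu x - u * Kop L nu x) / (a + Kop L nu x)
  else 0.

End dual_functional.

Section extended_functionals.
Local Open Scope ereal_scope.

Definition dom {R : realType} {V : Type} (F : V -> \bar R) : set V :=
  [set v | -oo < F v].

Definition maximizer {R : realType} {V : Type} (F : V -> \bar R) (v : V) :=
  forall v', F v' <= F v.

(* Meant for F : V -> [-oo, +oo[, so that no sum oo - oo occurs. *)
Definition concave {R : realType} {V : lmodType R} (F : V -> \bar R) :=
  forall (v v' : V) (t : R), (0 < t < 1)%R ->
    t%:E * F v + (1 - t)%:E * F v' <= F (t *: v + (1 - t) *: v')%R.

(* The mirror image of lower_semicontinuous. *)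
Definition upper_semicontinuous {R : realType} {X : topologicalType}
    (F : X -> \bar R) :=
  forall x (c : R), F x < c%:E ->
    exists2 V, nbhs x V & forall y, V y -> F y < c%:E.

Definition coercive {R : realType} {V : semiNormedZmodType R} (F : V -> \bar R) :=
  forall c : R, exists r : R, forall v, (r < `|v|)%R -> c%:E < F v.

End extended_functionals.

Definition smooth {R : realType} (f : R -> R) :=
  forall (n : nat) (x : R), derivable (derive1n n f) x 1.

(* Main.v *)
(* Write A = a + K nu and B = nu + u K nu - a wbar, so that S[nu] is the infimum
   over w of the integral of w^2 A / 2 + w B.
   (1) Where A >= 0, and B = 0 wherever A = 0, completing the square shows that
   hat w = -B/A minimizes the integrand pointwise, and truncations of hat w are
   admissible; on a set of positive measure where this fails, multiples of a
   suitable function make the integral arbitrarily negative.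
   (2) S is an infimum of functionals that are affine and continuous in nu,
   continuity resting on the self-adjointness of K.
   (3) A is bounded below by a positive constant as soon as it is positive, since
   it is continuous and either periodic or tending to a at infinity; this persists
   in a neighbourhood. If A(x0) <= 0, subtracting a small bump at x0 makes A
   negative near x0.
   (4) Weak compactness is avoided: the superlevel sets {S >= m - e} with
   m = sup S are convex, and by coercivity bounded, so elements of almost minimal
   norm in them form a Cauchy sequence by the parallelogram law. Its limit
   maximizes S by upper semicontinuity.
   (5) At nu + t h the integrand is, for every f, at least the one at (nu, hat w)
   plus t (K h hat w^2 / 2 + (h + u K h) hat w) minus O(t^2), so the first
   variation vanishes. By self-adjointness of K it is the pairing of h with
   F = hat w + u K hat w + K(hat w^2) / 2, whence F = 0 almost everywhere. Then
   w = - u K hat w - K(hat w^2) / 2 is a continuous representative of hat w with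
   w = - u K w - K(w^2) / 2, and K gains one derivative at each iteration. *)
Require Import Defs.
From HB Require Import structures.
From mathcomp Require Import all_boot all_order all_algebra.
From mathcomp Require Import all_classical all_reals all_analysis.
From mathcomp Require Import measurable_realfun ring lra.

Set Implicit Arguments.
Unset Strict Implicit.
Unset Printing Implicit Defensive.

Import Order.TTheory GRing.Theory Num.Theory.
Import numFieldNormedType.Exports.

Local Open Scope classical_set_scope.
Local Open Scope ring_scope.

Lemma norm_mul_le_sqrD (R : realFieldType) (a b : R) : `|a * b| <= a ^+ 2 + b ^+ 2.
Proof. by rewrite ler_norml; apply/andP; split; nra. Qed.

(** * Square-integrable functions *)

Section square_integrable.
Context d (T : measurableType d) (R : realType) (mu : {measure set T -> \bar R}).
Variables (D : set T) (mD : measurable D).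
Implicit Types f g h : T -> R.

(** A predicate on plain functions, so that truncations, [K f] and [what] can be handled without
    first being packed into [L2]. *)
Definition sqint f :=
  measurable_fun D f /\ mu.-integrable D (EFin \o (fun x => f x ^+ 2)).

Lemma le_Rintegrable f g : measurable_fun D f ->
  (forall x, D x -> `|f x| <= g x) ->
  mu.-integrable D (EFin \o g) -> mu.-integrable D (EFin \o f).
Proof.
move=> mf fg ig; apply: (le_integrable mD _ _ ig); first exact/measurable_EFinP.
move=> x Dx; rewrite /= lee_fin (le_trans (fg _ Dx))// ler_norm//.
Qed.

Lemma integrableDR f g : mu.-integrable D (EFin \o f) ->
  mu.-integrable D (EFin \o g) -> mu.-integrable D (EFin \o (fun x => f x + g x)).
Proof. by move=> fi gi; exact: (integrableD mD fi gi). Qed.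

Lemma integrableZR (k : R) f : mu.-integrable D (EFin \o f) ->
  mu.-integrable D (EFin \o (fun x => k * f x)).
Proof. by move=> fi; exact: (integrableZl mD k fi). Qed.

Lemma integrableMR (M : R) f g : measurable_fun D f ->
  (forall x, D x -> `|f x| <= M) -> mu.-integrable D (EFin \o g) ->
  mu.-integrable D (EFin \o (fun x => f x * g x)).
Proof.
move=> mf fM ig.
have mg : measurable_fun D g by apply/measurable_EFinP; exact: measurable_int ig.
apply: (@le_Rintegrable _ (fun x => M * `|g x|)).
- exact: measurable_funM.
- by move=> x Dx; rewrite normrM ler_wpM2r// fM.
- apply: integrableZR; exact: (integrable_norm ig).
Qed.

Lemma sqint_mul f g : sqint f -> sqint g ->
  mu.-integrable D (EFin \o (fun x => f x * g x)).
Proof.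
move=> [mf f2] [mg g2].
apply: (le_Rintegrable _ _ (integrableDR f2 g2)); first exact: measurable_funM.
by move=> x _; exact: norm_mul_le_sqrD.
Qed.

Lemma le_sqint f g : measurable_fun D f ->
  (forall x, D x -> f x ^+ 2 <= g x ^+ 2) -> sqint g -> sqint f.
Proof.
move=> mf fg [mg g2]; split => //.
apply: (le_Rintegrable _ _ g2); first exact: measurable_funX.
by move=> x Dx; rewrite ger0_norm ?sqr_ge0 ?fg.
Qed.

Lemma sqintZ (k : R) f : sqint f -> sqint (fun x => k * f x).
Proof.
move=> [mf f2]; split; first exact: measurable_funM.
apply: eq_integrable (integrableZR (k ^+ 2) f2) => // x _ /=.
by rewrite exprMn.
Qed.

Lemma sqintD f g : sqint f -> sqint g -> sqint (fun x => f x + g x).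
Proof.
move=> sf sg; have [[mf f2] [mg g2]] := (sf, sg).
split; first exact: measurable_funD.
have := integrableDR (integrableDR f2 g2) (integrableZR 2 (sqint_mul sf sg)).
apply: eq_integrable => // x _ /=; congr EFin; ring.
Qed.

Lemma sqintN f : sqint f -> sqint (fun x => - f x).
Proof. by move=> /(sqintZ (-1)); under eq_fun do rewrite mulN1r. Qed.

Lemma sqintB f g : sqint f -> sqint g -> sqint (fun x => f x - g x).
Proof. by move=> sf sg; apply: sqintD => //; exact: sqintN. Qed.

Lemma sqintMb (M : R) f g : measurable_fun D f ->
  (forall x, D x -> `|f x| <= M) -> sqint g -> sqint (fun x => f x * g x).
Proof.
move=> mf fM sg; apply: (le_sqint _ _ (sqintZ M sg)).
  by apply: measurable_funM => //; case: sg.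
move=> x Dx; rewrite !exprMn ler_wpM2r ?sqr_ge0//.
rewrite -[leLHS]real_normK ?num_real// ler_pXn2r ?nnegrE ?fM//.
by rewrite (le_trans _ (fM _ Dx)).
Qed.

Lemma Rintegral_sqr_ge0 f : 0 <= \int[mu]_(x in D) (f x ^+ 2).
Proof. by apply: Rintegral_ge0 => x _; exact: sqr_ge0. Qed.

(** The grouping as a quadratic polynomial in [t] is the one [quadratic_discr] expects; t = 1 and t
    = -1 together give the parallelogram law. *)
Lemma Rintegral_sqrD (t : R) f g : sqint f -> sqint g ->
  \int[mu]_(x in D) ((f x + t * g x) ^+ 2) =
  \int[mu]_(x in D) (f x ^+ 2) + t * (2 * \int[mu]_(x in D) (f x * g x)) +
  t ^+ 2 * \int[mu]_(x in D) (g x ^+ 2).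
Proof.
move=> sf sg; have [[mf f2] [mg g2]] := (sf, sg); have fg := sqint_mul sf sg.
rewrite -!RintegralZl//; last exact: integrableZR.
rewrite -!RintegralD//; do ?[exact: integrableDR|exact: integrableZR|
  apply: integrableDR => //; exact: integrableZR|
  apply: integrableZR => //; exact: integrableZR].
- by apply: eq_Rintegral => x _; ring.
- by apply: integrableDR => //; do 2 apply: integrableZR.
Qed.

Lemma quadratic_discr (F P G : R) : 0 <= G ->
  (forall t, 0 <= F + t * (2 * P) + t ^+ 2 * G) -> P ^+ 2 <= F * G.
Proof.
move=> G0 tP; have [Gz|Gn] := eqVneq G 0.
  rewrite Gz mulr0; have [->|Pn] := eqVneq P 0; first by rewrite expr0n.
  (* With [G = 0] the polynomial is affine in [t], and this [t] would give it the value -1. *)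
  have := tP (- (F + 1) / (2 * P)).
  rewrite Gz mulr0 addr0 divfK ?mulf_neq0//.
  by move=> ?; exfalso; lra.
have Gp : 0 < G by rewrite lt_neqAle eq_sym Gn.
(* The minimizer of the quadratic. *)
have := tP (- P / G).
have -> : F + - P / G * (2 * P) + (- P / G) ^+ 2 * G = (F * G - P ^+ 2) / G by field.
by rewrite pmulr_lge0 ?invr_gt0// subr_ge0.
Qed.

Lemma cauchy_schwarz_Rintegral f g : sqint f -> sqint g ->
  (\int[mu]_(x in D) (f x * g x)) ^+ 2 <=
  \int[mu]_(x in D) (f x ^+ 2) * \int[mu]_(x in D) (g x ^+ 2).
Proof.
move=> sf sg; apply: quadratic_discr; first exact: Rintegral_sqr_ge0.
by move=> t; rewrite -Rintegral_sqrD//; exact: Rintegral_sqr_ge0.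
Qed.

Lemma EFin_Rintegral f : mu.-integrable D (EFin \o f) ->
  (\int[mu]_(x in D) f x)%:E = (\int[mu]_(x in D) (f x)%:E)%E.
Proof. by move=> fi; rewrite fineK//; exact: integrable_fin_num fi. Qed.

End square_integrable.

(** The intervals of radius 2 A 2^-n around [u n] are nested, since the steps from n on add up to at
    most 2 A 2^-n; the supremum of their left ends lies in all of them. The sigma type lets a limit
    be picked at each point in [riesz_fischer_fast]. *)
Lemma geometric_cauchy_limit (R : realType) (u : nat -> R) (A : R) :
  (forall n, `|u n.+1 - u n| <= A * 2^-1 ^+ n) ->
  {l | forall n, `|u n - l| <= 2 * A * 2^-1 ^+ n}.
Proof.
move=> uA.
have A0 : 0 <= A by have := uA 0%N; rewrite expr0 mulr1; exact: le_trans.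
pose a n := u n - 2 * A * 2^-1 ^+ n; pose b n := u n + 2 * A * 2^-1 ^+ n.
have aS n : a n <= a n.+1.
  have := uA n; rewrite ler_norml /a exprS => /andP[+ _]; set q := 2^-1 ^+ n.
  by move=> ?; lra.
have bS n : b n.+1 <= b n.
  have := uA n; rewrite ler_norml /b exprS => /andP[_]; set q := 2^-1 ^+ n.
  by move=> ?; lra.
have ab n : a n <= b n.
  rewrite /a /b; have : 0 <= 2 * A * 2^-1 ^+ n by rewrite !mulr_ge0// exprn_ge0.
  by set q := _ * _ => ?; lra.
have am m n : (m <= n)%N -> a m <= a n.
  by move/subnKC <-; elim: (n - m)%N => [|k IH]; rewrite ?addn0// addnS (le_trans IH).
have bm m n : (m <= n)%N -> b n <= b m.
  by move/subnKC <-; elim: (n - m)%N => [|k IH]; rewrite ?addn0// addnS (le_trans _ IH).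
have amb m n : a m <= b n.
  have [mn|/ltnW nm] := leqP m n; first exact: le_trans (am _ _ mn) (ab n).
  exact: le_trans (ab m) (bm _ _ nm).
have hub n : ubound (range a) (b n) by move=> _ [m _ <-].
exists (sup (range a)) => n; rewrite ler_distlC.
apply/andP; split.
- apply: ub_le_sup; last by exists n.
  by exists (b 0%N); exact: hub.
- by apply: ge_sup; [exists (a 0%N), 0%N|exact: hub].
Qed.

(** * Completeness along fast Cauchy sequences *)

Section riesz_fischer.
Context d (T : measurableType d) (R : realType) (mu : {measure set T -> \bar R}).
Variables (D : set T) (mD : measurable D).

(** Let H be the sum of 4^n (f_{n+1} - f_n)^2. Its integral is at most the sum of 4^n 8^-n, which is
    2. Where H is finite the steps are at most sqrt(H) 2^-n, so a limit g exists with (f_n - g)^2 <=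
    4 H 4^-n, and integrating this yields the rate. *)
Lemma riesz_fischer_fast (f : nat -> T -> R) :
  (forall n, measurable_fun setT (f n)) -> (forall n, sqint mu D (f n)) ->
  (forall n, \int[mu]_(x in D) ((f n.+1 x - f n x) ^+ 2) <= 8^-1 ^+ n) ->
  exists g : T -> R, [/\ measurable_fun setT g, sqint mu D g &
    exists C : R, forall n,
      \int[mu]_(x in D) ((f n x - g x) ^+ 2) <= C * 4^-1 ^+ n].
Proof.
move=> mf sf fast.
have sdf n : sqint mu D (fun x => f n.+1 x - f n x) by exact: sqintB.
pose h n x := (4 ^+ n * (f n.+1 x - f n x) ^+ 2)%:E.
have h0 n x : (0 <= h n x)%E by rewrite lee_fin mulr_ge0 ?sqr_ge0 ?exprn_ge0//.
have mh n : measurable_fun setT (h n).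
  apply/measurable_EFinP/measurable_funM => //.
  by apply: measurable_funX; exact: measurable_funB.
pose H x := (\sum_(n <oo) h n x)%E.
have mH : measurable_fun setT H by apply: ge0_emeasurable_sum.
have H0 x : (0 <= H x)%E by exact: nneseries_ge0.
have int_h n : (\int[mu]_(x in D) h n x <= (2^-1 ^+ n)%:E)%E.
  rewrite -EFin_Rintegral//; last by apply: integrableZR => //; case: (sdf n).
  rewrite lee_fin RintegralZl//; last by case: (sdf n).
  rewrite (_ : 2^-1 = 4 * 8^-1); last by field.
  by rewrite exprMn ler_wpM2l// exprn_ge0.
have int_H : (\int[mu]_(x in D) H x <= 2%:E)%E.
  rewrite integral_nneseries//; last by move=> n; exact: measurable_funTS.
  apply: (@le_trans _ _ (\sum_(n <oo) (2^-1 ^+ n)%:E)%E).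
    apply: lee_nneseries => n _; last exact: int_h.
    by move=> _; apply: integral_ge0 => x _; exact: h0.
  apply: lime_le; first by apply: is_cvg_nneseries => n _ _; rewrite lee_fin exprn_ge0.
  apply: nearW => n; rewrite sumEFin lee_fin.
  suff -> : \sum_(0 <= i < n) 2^-1 ^+ i = 2 - 2 * 2^-1 ^+ n :> R.
    by rewrite gerBl mulr_ge0// exprn_ge0.
  elim: n => [|n IH]; first by rewrite big_geq// expr0; ring.
  by rewrite big_nat_recr//= IH exprS; field.
have int_Hfin : (\int[mu]_(x in D) H x < +oo)%E by exact: le_lt_trans int_H (ltry _).
pose E := [set x | (H x < +oo)%E].
have mE : measurable E.
  by rewrite /E -[X in measurable X]setTI; exact: emeasurable_fun_infty_o.
have step x : E x -> forall n, `|f n.+1 x - f n x| <=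
    Num.sqrt (fine (H x)) * 2^-1 ^+ n.
  move=> Ex n.
  have Hx : (fine (H x))%:E = H x by rewrite fineK// ge0_fin_numE.
  have hH : 4 ^+ n * (f n.+1 x - f n x) ^+ 2 <= fine (H x).
    rewrite -lee_fin Hx; apply: le_trans (nneseries_lim_ge n.+1 _) => //.
    by rewrite big_nat_recr//= leeDr// sume_ge0.
  have -> : 2^-1 ^+ n = Num.sqrt (4^-1 ^+ n) :> R.
    by rewrite (_ : 4^-1 = 2^-1 ^+ 2); [rewrite -exprAC sqrtr_sqr ger0_norm// exprn_ge0|field].
  rewrite -sqrtrM ?fine_ge0// -[leLHS]sqrtr_sqr ler_wsqrtr//.
  by rewrite exprVn ler_pdivlMr ?exprn_gt0// mulrC.
have lx x : {l : R | E x -> forall n, `|f n x - l| <= 2 * Num.sqrt (fine (H x)) * 2^-1 ^+ n}.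
  case: (pselect (E x)) => [Ex|nEx]; last by exists 0.
  by have [l lP] := geometric_cauchy_limit (step x Ex); exists l.
(* Off [E] the choice [lx] carries no information; the indicator makes [g] vanish there, and hence a
   pointwise limit of the measurable functions [\1_E x * f n x]. *)
pose g x := \1_E x * sval (lx x).
have gP x : E x -> forall n, (f n x - g x) ^+ 2 <= 4 * fine (H x) * 4^-1 ^+ n.
  move=> Ex n; rewrite /g indicE mem_set// mul1r.
  have := svalP (lx x) Ex n; rewrite -ler_sqr ?nnegrE; last 2 first.
  - by [].
  - by rewrite !mulr_ge0 ?sqrtr_ge0 ?exprn_ge0.
  rewrite real_normK ?num_real// => /le_trans; apply.
  rewrite !exprMn sqr_sqrtr ?fine_ge0// -exprM mulnC exprM.
  have -> : 2 ^+ 2 = 4 :> R by ring.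
  by have -> : 2^-1 ^+ 2 = 4^-1 :> R by field.
have mg : measurable_fun setT g.
  apply: (@measurable_fun_cvg _ _ _ _ (fun n x => \1_E x * f n x)) => //.
    by move=> n; exact: measurable_funM.
  move=> x _; rewrite /g indicE; have [Ex|nEx] := pselect (E x); last first.
    by rewrite memNset// mul0r; under eq_cvg do rewrite mul0r; exact: cvg_cst.
  rewrite mem_set// mul1r; under eq_cvg do rewrite mul1r.
  have := svalP (lx x) Ex; set l := sval _; set s := 2 * _ => ls.
  have geo0 : geometric s 2^-1 n @[n --> \oo] --> (0 : R).
    by apply: cvg_geometric; rewrite ger0_norm// invf_lt1// ltr1n.
  apply: (@squeeze_cvgr _ _ _ _ (fun n => l - geometric s 2^-1 n)
    (fun n => l + geometric s 2^-1 n)).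
  - by apply: nearW => n; rewrite -ler_distlC distrC; exact: ls.
  - by rewrite -[X in _ --> X]subr0; apply: cvgB => //; exact: cvg_cst.
  - by rewrite -[X in _ --> X]addr0; apply: cvgD => //; exact: cvg_cst.
have mfg n : measurable_fun setT (fun x => (f n x - g x) ^+ 2).
  by apply: measurable_funX; exact: measurable_funB.
have fgH n : (\int[mu]_(x in D) ((f n x - g x) ^+ 2)%:E <= (8 * 4^-1 ^+ n)%:E)%E.
  apply: (@le_trans _ _ (\int[mu]_(x in D) ((4 * 4^-1 ^+ n)%:E * H x))%E).
    apply: ge0_le_integral => //.
    - by move=> x _; rewrite lee_fin sqr_ge0.
    - by apply/measurable_EFinP; exact: measurable_funTS.
    - by apply: measurable_funeM; exact: measurable_funTS.
    move=> x _; have [Ex|nEx] := pselect (E x).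
      by rewrite -(@fineK _ (H x)) ?ge0_fin_numE// -EFinM lee_fin mulrAC; exact: gP.
    (* Off [E] the bound is trivial, its right side being infinite. *)
    have -> : H x = +oo%E by apply/eqP; rewrite -leye_eq leNgt; exact/negP.
    by rewrite gt0_muley ?leey// lte_fin mulr_gt0// exprn_gt0.
  rewrite ge0_integralZl//; last exact: measurable_funTS.
  rewrite (_ : 8 * 4^-1 ^+ n = 4 * 4^-1 ^+ n * 2); last by ring.
  by rewrite [leRHS]EFinM lee_wpmul2l// lee_fin mulr_ge0// exprn_ge0.
have sfg n : sqint mu D (fun x => f n x - g x).
  split; first by apply: measurable_funTS; exact: measurable_funB.
  apply/integrableP; split; first by apply/measurable_EFinP; exact: measurable_funTS.
  under eq_integral => x _ do rewrite /= ger0_norm ?sqr_ge0//.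
  exact: le_lt_trans (fgH n) (ltry _).
exists g; split => //.
- have := sqintB mD (sf 0%N) (sfg 0%N).
  by under eq_fun do rewrite subKr.
- exists 8 => n; rewrite -lee_fin EFin_Rintegral//.
  by case: (sfg n).
Qed.
End riesz_fischer.

(** * Integrals of periodic functions *)

Section shift.
Context {R : realType}.
Local Notation mu := (@lebesgue_measure R).
Implicit Types (F : R -> \bar R) (a b c s t : R).

Lemma measurable_addr s : measurable_fun setT (fun x : R => x + s).
Proof. exact: measurable_funD. Qed.

Lemma itvco_shift a b s :
  [set x | `[a, b[%classic (x + s)] = `[a - s, b - s[%classic.
Proof. by apply/seteqP; split=> x /=; rewrite !in_itv/= lerBlDr ltrBrDr. Qed.

(** Translation carries half-open intervals to half-open intervals of the same length, so by
    uniqueness of Lebesgue measure its pushforward under translation is Lebesgue measure again. *)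
Lemma ge0_integral_shift s (D : set R) F : measurable D ->
  measurable_fun setT F -> (forall x, 0 <= F x)%E ->
  (\int[mu]_(x in D) F x = \int[mu]_(x in [set x | D (x + s)%R]) F (x + s)%R)%E.
Proof.
move=> mD mF F0.
have mphi : measurable_fun [set: measurableTypeR R]
    ((fun x => x + s) : measurableTypeR R -> measurableTypeR R).
  exact: measurable_addr.
pose phi : {mfun measurableTypeR R >-> measurableTypeR R} :=
  HB.pack ((fun x => x + s) : measurableTypeR R -> measurableTypeR R)
    (isMeasurableFun.Build _ _ _ _ _ mphi).
rewrite -(@ge0_integral_pushforward _ _ _ _ _ phi mphi mu D F)//; last first.
  exact: measurable_funTS.
apply: eq_measure_integral => //= A mA _.
apply: lebesgue_measure_unique => //= _ [[x y]] _ <-.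
rewrite /pushforward (_ : _ @^-1` _ = `]x - s, y - s]%classic); last first.
  by apply/seteqP; split=> z /=; rewrite !in_itv/= ltrBlDr lerBrDr.
rewrite !lebesgue_measure_itv/= !lte_fin ltrD2r.
by case: ifPn => // _; rewrite -!EFinB; congr EFin; ring.
Qed.

Section periodic_window.
Variables (T : R) (F : R -> \bar R).
Hypothesis (T_gt0 : 0 < T) (mF : measurable_fun setT F).
Hypothesis (F_ge0 : forall x, (0 <= F x)%E) (perF : forall x, F (x + T) = F x).

Let W c := (\int[mu]_(x in `[c, (c + T)%R[) F x)%E.

Lemma ge0_integral_itv_split a b c : a <= b -> b <= c ->
  (\int[mu]_(x in `[a, c[) F x =
   \int[mu]_(x in `[a, b[) F x + \int[mu]_(x in `[b, c[) F x)%E.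
Proof.
move=> ab bc; rewrite (@itv_bndbnd_setU _ _ _ (BLeft b)) ?bnd_simp//.
rewrite ge0_integral_setU//; first exact: measurable_funTS.
apply/disj_setPS => x [] /=; rewrite !in_itv/= => /andP[_ xb] /andP[bx _].
by rewrite leNgt xb in bx.
Qed.

(** For a shift by at most one period, the piece lost on the left translates by [T] onto the piece
    gained on the right. Longer shifts follow by induction, negative ones by reading the identity
    backwards. *)
Lemma periodic_window_shift c : W c = W 0.
Proof.
have small e d : 0 <= d -> d <= T -> W (e + d) = W e.
  move=> d0 dT; rewrite /W (@ge0_integral_itv_split (e + d) (e + T)); [|lra..].
  rewrite (@ge0_integral_itv_split e (e + d) (e + T)); [|lra..].
  rewrite addeC; congr (_ + _)%E.
  rewrite (@ge0_integral_shift T)// itvco_shift.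
  rewrite (_ : e + T - T = e); last by ring.
  rewrite (_ : e + d + T - T = e + d); last by ring.
  by apply: eq_integral => x _; rewrite perF.
have large n e d : 0 <= d -> d <= n%:R * T -> W (e + d) = W e.
  elim: n d => [|n IH] d d0.
    by rewrite mul0r => d1; rewrite (_ : d = 0) ?addr0//; lra.
  move=> dn; have [dT|Td] := leP d T; first exact: small.
  rewrite (_ : e + d = e + (d - T) + T); last by ring.
  rewrite small ?(ltW T_gt0)//; apply: IH; first lra.
  by move: dn; rewrite -natr1 mulrDl mul1r; lra.
have nonneg e d : 0 <= d -> W (e + d) = W e.
  move=> d0; apply: (large (Num.truncn (d / T)).+1) => //.
  by rewrite -ler_pdivrMr// ltW// truncnS_gt.
have [c0|/ltW c0] := leP 0 c; first by rewrite -(nonneg 0 c)// add0r.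
by rewrite -[in RHS](addrN c) nonneg// oppr_ge0.
Qed.

Lemma periodic_windows n c :
  (\int[mu]_(x in `[c, (c + n%:R * T)%R[) F x = n%:R%:E * W 0)%E.
Proof.
elim: n => [|n IH].
  by rewrite mul0r addr0 set_itvco0 integral_set0 mul0e.
rewrite (@ge0_integral_itv_split _ (c + n%:R * T)).
- rewrite IH -(periodic_window_shift (c + n%:R * T)) /W.
  rewrite (_ : c + n.+1%:R * T = c + n%:R * T + T); last by rewrite -natr1; ring.
  by rewrite -natr1 EFinD ge0_muleDl ?lee_fin// mul1e.
- by rewrite lerDl mulr_ge0// ltW.
- by rewrite lerD2l ler_pM2r// ler_nat.
Qed.

End periodic_window.

(** For infinite [L] the condition is vacuous, which lets the line and the torus be treated by the
    same statements. *)
Definition Lperiodic {U : Type} (L : \bar R) (F : R -> U) :=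
  forall r : R, L = r%:E -> forall x, F (x + 2 * r) = F x.

Lemma integral_Omega_finite (r : R) F : measurable_fun setT F ->
  (\int[mu]_(x in Omega r%:E) F x = \int[mu]_(x in `[(- r)%R, (- r + 2 * r)%R[) F x)%E.
Proof.
move=> mF; rewrite (_ : - r + 2 * r = r); last by ring.
rewrite integral_itv_bndoo; last exact: measurable_funTS.
by congr (integral _ _ _); apply/seteqP; split=> x /=;
  rewrite /Omega/= in_itv/= !lte_fin.
Qed.

Lemma OmegaT : Omega +oo%E = setT :> set (measurableTypeR R).
Proof. by apply/seteqP; split=> x //= _; rewrite /Omega/= ltNyr ltry. Qed.

Variables (L : \bar R) (L_gt0 : (0 < L)%E).

Lemma ge0_integral_Omega_shift s F : measurable_fun setT F ->
  (forall x, 0 <= F x)%E -> Lperiodic L F ->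
  (\int[mu]_(x in Omega L) F (x + s)%R = \int[mu]_(x in Omega L) F x)%E.
Proof.
move=> mF F0 pF.
have mFs : measurable_fun setT (fun x : R => F (x + s)).
  by apply: measurableT_comp => //; exact: measurable_addr.
case: L L_gt0 pF => [r|_ _|//]; last first.
  by rewrite !OmegaT [RHS](@ge0_integral_shift s setT).
rewrite lte_fin => r0 /(_ _ erefl) pF; rewrite !integral_Omega_finite//.
rewrite periodic_window_shift//; last 2 first.
- by rewrite mulr_gt0.
- by move=> x; rewrite addrAC pF.
rewrite [RHS]periodic_window_shift ?mulr_gt0//.
rewrite -(@periodic_window_shift (2 * r) F _ _ _ _ s) ?mulr_gt0//.
rewrite [RHS](@ge0_integral_shift s)// itvco_shift.
by rewrite subrr add0r (_ : s + 2 * r - s = 2 * r)//; ring.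
Qed.

(** A window of length [d] is covered by finitely many periods, or lies in Omega when that is the
    whole line. [C] depends neither on [F] nor on [x], which makes the bounds on [K] uniform. *)
Lemma ge0_integral_window (d : R) : exists2 C : R, 0 <= C &
  forall F, measurable_fun setT F -> (forall x, 0 <= F x)%E -> Lperiodic L F ->
  forall x, (\int[mu]_(y in `[x, (x + d)%R]) F y <=
             C%:E * \int[mu]_(y in Omega L) F y)%E.
Proof.
case: L L_gt0 => [r|_|//]; last first.
  exists 1 => // F mF F0 _ x; rewrite mul1e OmegaT.
  by apply: ge0_subset_integral.
rewrite lte_fin => r0; pose n := (Num.truncn (d / (2 * r))).+1.
have r20 : 0 < 2 * r by rewrite mulr_gt0.
have dn : d < n%:R * (2 * r) by rewrite -ltr_pdivrMr// truncnS_gt.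
exists n%:R => // F mF F0 /(_ _ erefl) pF x.
rewrite integral_Omega_finite// periodic_window_shift//.
rewrite -(periodic_windows r20 mF F0 pF n x).
apply: ge0_subset_integral => //; first exact: measurable_funTS.
by apply: subset_itvl; rewrite bnd_simp ltrD2l.
Qed.

End shift.

(** * Periodic extension from Omega to the line *)

Section periodic_extension.
Context {R : realType} (L : \bar R) (L_gt0 : (0 < L)%E).
Local Notation mu := (@lebesgue_measure R).
Local Notation TR := (measurableTypeR R).
Local Notation ext := (periodic_ext L).
Implicit Types (f g : R -> R) (x y : R).

(** [ext id] is the map folding the line onto one period. Every extension factors through it, so
    measurability need be checked for this one map only. *)
Lemma periodic_extE f x : ext f x = f (ext id x).
Proof. by case: L. Qed.

Lemma measurable_EFin_comp f : measurable_fun setT f ->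
  measurable_fun setT (fun x : R => (f x)%:E).
Proof. by move=> mf; exact/measurable_EFinP. Qed.

Lemma measurable_itvR (i : interval R) : measurable ([set` i] : set TR).
Proof. exact: measurable_itv. Qed.

Lemma measurable_periodic_ext f :
  measurable_fun setT f -> measurable_fun setT (ext f).
Proof.
move=> mf; rewrite (_ : ext f = f \o ext id); last first.
  by apply/funext => x; rewrite periodic_extE.
apply: measurableT_comp => //; rewrite /periodic_ext.
case: L L_gt0 => [r|_|//]; last exact: measurable_id.
rewrite lte_fin => r0; apply: measurable_funB => //; apply: measurable_funM => //.
(* The integer part is monotone, hence measurable. *)
apply: nondecreasing_measurable => // x y xy.
by rewrite ler_int le_floor// ler_pM2r ?invr_gt0 ?mulr_gt0// lerD2r.
Qed.

Lemma Lperiodic_ext f : Lperiodic L (ext f).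
Proof.
move=> r Lr x; move: L_gt0; rewrite /periodic_ext Lr lte_fin => r0.
have r20 : 2 * r != 0 by rewrite gt_eqF// mulr_gt0.
rewrite (_ : (x + 2 * r + r) / (2 * r) = (x + r) / (2 * r) + 1); last first.
  by field; rewrite gt_eqF.
by rewrite floorDrz// floor1 intrD mulrDr mulr1; congr f; ring.
Qed.

Lemma periodic_int f (T : R) (m : int) x :
  (forall z, f (z + T) = f z) -> f (x + T * m%:~R) = f x.
Proof.
move=> pf; have nat_per n z : f (z + T * n%:R) = f z.
  elim: n => [|n IH]; first by rewrite mulr0 addr0.
  by rewrite -natr1 mulrDr mulr1 addrA pf IH.
case: m => [n|n]; first exact: nat_per.
rewrite NegzE mulrNz mulrN -(nat_per n.+1 (x - _)) -[n.+1%:~R]/(n.+1%:R).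
by rewrite subrK.
Qed.

Lemma periodic_ext_id f x : Lperiodic L f -> ext f x = f x.
Proof.
rewrite /periodic_ext; case: L => [r pf|//|//].
by rewrite -mulrN -mulrNz (periodic_int (T := 2 * r))// => z; exact: pf.
Qed.

Lemma periodic_ext_Omega f x : Omega L x -> ext f x = f x.
Proof.
rewrite /Omega /periodic_ext/=; case: L L_gt0 => [r|//|//].
rewrite !lte_fin => r0 /andP[rx xr].
rewrite (_ : Num.floor _ = 0) ?mulr0 ?subr0//; apply: floor_def.
have r20 : 0 < 2 * r by rewrite mulr_gt0.
by rewrite add0r divr_ge0 ?ltr_pdivrMr ?(ltW r20)//=; lra.
Qed.

(** Folding moves no point away from the origin, so the extension of the indicator of a symmetric
    interval is still 1 on that interval; the bump in [frakS_interior] rests on this. *)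
Lemma norm_periodic_ext_id x : `|ext id x| <= `|x|.
Proof.
rewrite /periodic_ext; case: L L_gt0 => [r|//|//]; rewrite lte_fin => r0.
have r20 : 0 < 2 * r by rewrite mulr_gt0.
set m := Num.floor _; have fl := floor_le ((x + r) / (2 * r)).
have fu := floorD1_gt ((x + r) / (2 * r)).
rewrite -/m in fl fu; rewrite ler_pdivlMr// in fl; rewrite intrD ltr_pdivrMr// in fu.
have [xr|rx] := ltP x (- r).
  by rewrite [leRHS]ler0_norm ?ler_norml; [|lra]; apply/andP; split; nra.
have [rx'|xr] := leP r x.
  by rewrite [leRHS]ger0_norm ?ler_norml; [|lra]; apply/andP; split; nra.
suff -> : m = 0 by rewrite mulr0 subr0.
apply: floor_def; rewrite add0r divr_ge0 ?ltr_pdivrMr ?(ltW r20)//=; lra.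
Qed.

Lemma integral_Omega_ext (h : R -> \bar R) :
  (\int[mu]_(x in Omega L) h (ext id x) = \int[mu]_(x in Omega L) h x)%E.
Proof.
by apply: eq_integral => x; rewrite inE => Ox; rewrite periodic_ext_Omega.
Qed.

Lemma measurable_comp_ext (h : R -> \bar R) :
  measurable_fun setT h -> measurable_fun setT (fun x : R => h (ext id x)).
Proof.
move=> mh; apply: measurableT_comp => //.
exact: (measurable_periodic_ext (@measurable_id _ _ setT)).
Qed.

Lemma Lperiodic_comp_ext U (h : R -> U) : Lperiodic L (fun x => h (ext id x)).
Proof. by move=> r Lr x; rewrite (Lperiodic_ext _ Lr). Qed.

Lemma integrable_itv_ext f (a b : R) : measurable_fun setT f ->
  mu.-integrable (Omega L) (EFin \o f) -> mu.-integrable `[a, b] (EFin \o ext f).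
Proof.
move=> mf fi; apply/integrableP; split.
  by apply/measurable_EFinP/measurable_funTS; exact: measurable_periodic_ext.
have [C C0 win] := ge0_integral_window L_gt0 (b - a).
pose h x := (`|f x|)%:E.
have mh : measurable_fun setT h by apply/measurable_EFinP; exact: measurableT_comp.
have := win (fun x => h (ext id x)) (measurable_comp_ext mh) _
  (@Lperiodic_comp_ext _ _) a.
rewrite (_ : a + (b - a) = b); last by ring.
rewrite integral_Omega_ext => H.
under eq_integral => x _ do rewrite /= periodic_extE.
apply: (le_lt_trans (H _)) => [x|]; first by rewrite lee_fin.
by rewrite lte_mul_pinfty//; case/integrableP : fi.
Qed.

Lemma sqint_itv_ext f (a b : R) : measurable_fun setT f ->
  sqint mu (Omega L) f -> sqint mu `[a, b] (ext f).
Proof.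
move=> mf [_ f2]; split.
  by apply: measurable_funTS; exact: measurable_periodic_ext.
have := integrable_itv_ext a b (measurable_funX 2 mf) f2.
by apply: eq_integrable => // x _ /=; rewrite (periodic_extE (fun x => f x ^+ 2)) (periodic_extE f).
Qed.

Lemma sqint_cst_itv (a b k : R) : sqint mu `[a, b] (cst k).
Proof.
split; first exact: measurable_cst.
apply: measurable_bounded_integrable => //.
- rewrite [X in (X < _)%E]lebesgue_measure_itv.
  by case: ifPn => // _; rewrite -EFinB ltry.
- exact: measurable_funX.
- by exists `|k ^+ 2|; split; [exact: num_real|move=> M kM x _ /=; exact: ltW].
Qed.

Lemma sqint_integrable_itv (a b : R) f :
  sqint mu `[a, b] f -> mu.-integrable `[a, b] (EFin \o f).
Proof.
move=> sf; have mI : measurable (`[a, b]%classic : set TR) by exact: measurable_itv.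
have := sqint_mul mI (sqint_cst_itv a b 1) sf.
by apply: eq_integrable => // x _ /=; rewrite mul1r.
Qed.

(** The regularity shared by L^2 and L^1 functions under which [Kop] is a genuine integral; [K] is
    applied both to w and to w^2. *)
Definition locally_integrable_ext f :=
  measurable_fun setT f /\ forall a b : R, mu.-integrable `[a, b] (EFin \o ext f).

Lemma integrable_locally_ext f : measurable_fun setT f ->
  mu.-integrable (Omega L) (EFin \o f) -> locally_integrable_ext f.
Proof. by move=> mf fi; split => // a b; exact: integrable_itv_ext. Qed.

Lemma sqint_locally_ext f : measurable_fun setT f ->
  sqint mu (Omega L) f -> locally_integrable_ext f.
Proof.
move=> mf fi; split => // a b; apply: sqint_integrable_itv; exact: sqint_itv_ext.
Qed.

End periodic_extension.

(** * Averages over a moving window *)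

Section moving_average.
Context {R : realType}.
Local Notation mu := (@lebesgue_measure R).
Variable G : R -> R.
Hypothesis iG : forall a b : R, mu.-integrable `[a, b] (EFin \o G).

(** A fixed base point [c] turns the moving window into a difference of two values of one primitive,
    to which continuity and the fundamental theorem of calculus apply. *)
Lemma moving_integralE (c x : R) : c <= x - 1 ->
  \int[mu]_(y in `[x - 1, x + 1]) G y =
  \int[mu]_(y in `[c, x + 1]) G y - \int[mu]_(y in `[c, x - 1]) G y.
Proof.
move=> cx; rewrite Rintegral_itvB//.
- by rewrite Rintegral_itv_obnd_cbnd//; apply: integrableS (iG (x - 1) (x + 1)) => //;
    apply: subset_itvr; rewrite bnd_simp.
- by rewrite bnd_simp; lra.
Qed.

Lemma integral_upper_continuous (c x : R) : c < x ->
  {for x, continuous (fun t => \int[mu]_(y in `[c, t]) G y)}.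
Proof.
move=> cx; have cx1 : c < x + 1 by lra.
have := parameterized_integral_continuous (ltW cx1) (iG c (x + 1)).
move=> /(continuous_within_itvP _ cx1)[+ _ _]; apply.
by rewrite in_itv/= cx/=; lra.
Qed.

Lemma near_moving_integralE (x : R) : \forall z \near x,
  \int[mu]_(y in `[z - 1, z + 1]) G y =
  \int[mu]_(y in `[x - 2, z + 1]) G y - \int[mu]_(y in `[x - 2, z - 1]) G y.
Proof.
(* For |z - x| < 1 both ends of the window around [z] lie to the right of the base point [x - 2]. *)
exists 1 => //= z; rewrite /ball_/= ltr_distlC => /andP[xz _].
by apply: moving_integralE; lra.
Qed.

Lemma moving_integral_continuous :
  continuous (fun x : R => \int[mu]_(y in `[x - 1, x + 1]) G y : R).
Proof.
move=> x; have xE := near_moving_integralE x.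
rewrite /continuous_at (nbhs_singleton xE).
suff : (\int[mu]_(y in `[x - 2, z + 1]) G y -
    \int[mu]_(y in `[x - 2, z - 1]) G y) @[z --> x] -->
    (\int[mu]_(y in `[x - 2, x + 1]) G y - \int[mu]_(y in `[x - 2, x - 1]) G y : R).
  by apply: cvg_trans; apply: near_eq_cvg; apply: filterS xE => z ->.
apply: cvgB.
- apply: (@cvg_comp _ _ _ (fun z => z + 1) (fun t => \int[mu]_(y in `[x - 2, t]) G y)
    _ (nbhs (x + 1))).
    by apply: cvgD; [exact: cvg_id|exact: cvg_cst].
  by apply: integral_upper_continuous; lra.
- apply: (@cvg_comp _ _ _ (fun z => z - 1) (fun t => \int[mu]_(y in `[x - 2, t]) G y)
    _ (nbhs (x - 1))).
    by apply: cvgB; [exact: cvg_id|exact: cvg_cst].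
  by apply: integral_upper_continuous; lra.
Qed.

Lemma is_derive_moving_integral (x : R) : continuous G ->
  is_derive x 1 (fun x => \int[mu]_(y in `[x - 1, x + 1]) G y) (G (x + 1) - G (x - 1)).
Proof.
move=> cG; have xE := near_moving_integralE x.
have upper t : x - 2 < t ->
    is_derive t 1 (fun t => \int[mu]_(y in `[x - 2, t]) G y) (G t).
  move=> xt; have [] := @continuous_FTC1_closed _ G (x - 2) t (t + 1) _ (iG _ _) xt (cG t).
    by rewrite ltrDl.
  by rewrite derive1E => dF <-; exact/derivableP.
suff : is_derive x 1 (fun z => \int[mu]_(y in `[x - 2, z + 1]) G y -
    \int[mu]_(y in `[x - 2, z - 1]) G y) (G (x + 1) - G (x - 1)).
  by apply: near_eq_is_derive; apply: filterS xE => z ->.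
apply: is_deriveB.
- rewrite -[X in is_derive _ _ _ X]mulr1.
  by apply: (@is_derive1_comp _ (fun t => \int[mu]_(y in `[x - 2, t]) G y) (fun z => z + 1));
   [apply: upper; lra|rewrite -[X in is_derive _ _ _ X]addr0; apply: is_deriveD].
- rewrite -[X in is_derive _ _ _ X]mulr1.
  by apply: (@is_derive1_comp _ (fun t => \int[mu]_(y in `[x - 2, t]) G y) (fun z => z - 1));
   [apply: upper; lra|rewrite -[X in is_derive _ _ _ X]subr0; apply: is_deriveB].
Qed.

End moving_average.

(** * Translations and reflections of signed integrals *)

Section isometries.
Context {R : realType}.
Local Notation mu := (@lebesgue_measure R).
Local Notation TR := (measurableTypeR R).
Implicit Types (F : R -> \bar R) (D : set R).

Lemma integral_shift s D F : measurable D -> measurable_fun setT F ->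
  (\int[mu]_(x in D) F x = \int[mu]_(x in [set x | D (x + s)%R]) F (x + s)%R)%E.
Proof.
move=> mD mF; rewrite integralE [RHS]integralE; congr (_ - _)%E.
- by rewrite (@ge0_integral_shift R s D F^\+%E mD (measurable_funepos mF) (funepos_ge0 F));
    apply: eq_integral => x _; rewrite !funeposE.
- by rewrite (@ge0_integral_shift R s D F^\-%E mD (measurable_funeneg mF) (funeneg_ge0 F));
    apply: eq_integral => x _; rewrite !funenegE.
Qed.

Lemma ge0_integral_reflect D F : measurable D -> measurable_fun setT F ->
  (forall x, 0 <= F x)%E ->
  (\int[mu]_(x in D) F x = \int[mu]_(x in [set x | D (- x)%R]) F (- x)%R)%E.
Proof.
move=> mD mF F0.
have mN : measurable_fun [set: TR] (-%R : TR -> TR) by exact: oppr_measurable.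
rewrite -(@ge0_integral_pushforward _ _ TR TR R -%R mN mu D F)//; last first.
  exact: measurable_funTS.
by apply: eq_measure_integral => //= A mA _; exact/esym/lebesgue_measureN.
Qed.

Lemma integral_reflect D F : measurable D -> measurable_fun setT F ->
  (\int[mu]_(x in D) F x = \int[mu]_(x in [set x | D (- x)%R]) F (- x)%R)%E.
Proof.
move=> mD mF; rewrite integralE [RHS]integralE; congr (_ - _)%E.
- by rewrite (@ge0_integral_reflect D F^\+%E mD (measurable_funepos mF) (funepos_ge0 F));
    apply: eq_integral => x _; rewrite !funeposE.
- by rewrite (@ge0_integral_reflect D F^\-%E mD (measurable_funeneg mF) (funeneg_ge0 F));
    apply: eq_integral => x _; rewrite !funenegE.
Qed.

(** Both signs are provided because the two sides of the self-adjointness identity use opposite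
    ones. *)
Lemma integral_centered (sg x : R) F : sg = 1 \/ sg = -1 ->
  measurable_fun setT F ->
  (\int[mu]_(y in `[(x - 1)%R, (x + 1)%R]) F y =
   \int[mu]_(s in `[(-1)%R, 1%R]) F (x + sg * s)%R)%E.
Proof.
move=> sgE mF.
have shifted : (\int[mu]_(y in `[(x - 1)%R, (x + 1)%R]) F y =
   \int[mu]_(s in `[(-1)%R, 1%R]) F (s + x)%R)%E.
  rewrite (integral_shift x (measurable_itvR _) mF); congr (integral mu _ _).
  by apply/seteqP; split=> s /=; rewrite !in_itv/=; lra.
rewrite shifted; case: sgE => ->.
  by apply: eq_integral => s _; rewrite mul1r addrC.
rewrite (@integral_reflect _ (fun s => F (s + x)))//; last first.
  by apply: measurableT_comp => //; exact: measurable_addr.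
rewrite (_ : [set s | _] = `[-1, 1]%classic); last first.
  by apply/seteqP; split=> s /=; rewrite !in_itv/=; lra.
by apply: eq_integral => s _; rewrite mulN1r addrC.
Qed.

Lemma integral_Omega_shift (L : \bar R) (L_gt0 : (0 < L)%E) s F :
  measurable_fun setT F -> Lperiodic L F ->
  (\int[mu]_(x in Omega L) F (x + s)%R = \int[mu]_(x in Omega L) F x)%E.
Proof.
move=> mF pF; rewrite integralE [RHS]integralE; congr (_ - _)%E.
- rewrite -(@ge0_integral_Omega_shift R L L_gt0 s F^\+%E (measurable_funepos mF) (funepos_ge0 F)).
    by apply: eq_integral => x _; rewrite !funeposE.
  by move=> r Lr x; rewrite !funeposE (pF _ Lr).
- rewrite -(@ge0_integral_Omega_shift R L L_gt0 s F^\-%E (measurable_funeneg mF) (funeneg_ge0 F)).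
    by apply: eq_integral => x _; rewrite !funenegE.
  by move=> r Lr x; rewrite !funenegE (pF _ Lr).
Qed.

End isometries.

(** * The convolution operator *)

Section Kop.
Context {R : realType} (L : \bar R) (L_gt0 : (0 < L)%E).
Local Notation mu := (@lebesgue_measure R).
Local Notation TR := (measurableTypeR R).
Local Notation ext := (periodic_ext L).
Local Notation LI := (locally_integrable_ext L).
Local Notation K := (Kop L).
Local Notation mO := (measurable_Omega L).
Implicit Types (f g p q : R -> R) (x y : R).

Lemma Kop_continuous f : LI f -> continuous (K f).
Proof. by move=> [_ fi]; exact: moving_integral_continuous. Qed.

Lemma measurable_Kop f : LI f -> measurable_fun setT (K f).
Proof. by move=> /Kop_continuous; exact: continuous_measurable_fun. Qed.

Lemma EFin_Kop f x : LI f ->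
  (K f x)%:E = (\int[mu]_(y in `[(x - 1)%R, (x + 1)%R]) (ext f y)%:E)%E.
Proof. by move=> [_ fi]; rewrite /Kop EFin_Rintegral. Qed.

Lemma Lperiodic_Kop f : LI f -> Lperiodic L (K f).
Proof.
move=> fLI r Lr x; apply: EFin_inj; rewrite !EFin_Kop//.
have mf : measurable_fun setT (fun y : R => (ext f y)%:E).
  by apply/measurable_EFinP; apply: measurable_periodic_ext => //; case: fLI.
rewrite !(@integral_centered _ 1)//; try by left.
by apply: eq_integral => s _; rewrite addrAC (Lperiodic_ext L_gt0 f Lr).
Qed.

Lemma KopD (t s : R) f g x : LI f -> LI g ->
  K (fun y => t * f y + s * g y) x = t * K f x + s * K g x.
Proof.
move=> [_ fi] [_ gi]; rewrite /Kop -!RintegralZl// -RintegralD//; last 2 first.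
- exact: integrableZR.
- exact: integrableZR.
apply: eq_Rintegral => y _; rewrite periodic_extE.
by rewrite [in RHS](periodic_extE L f) [in RHS](periodic_extE L g).
Qed.

(** Cauchy-Schwarz against the constant 1; the factor 2 is the length of the window. *)
Lemma Kop_sqr_le f x : measurable_fun setT f -> sqint mu (Omega L) f ->
  K f x ^+ 2 <= 2 * K (fun y => f y ^+ 2) x.
Proof.
move=> mf sf; have mI : measurable (`[x - 1, x + 1]%classic : set TR).
  exact: measurable_itv.
have := cauchy_schwarz_Rintegral mI (sqint_cst_itv _ _ 1) (sqint_itv_ext L_gt0 (x - 1) (x + 1) mf sf).
rewrite (_ : \int[mu]_(y in _) (cst 1 y * _) = K f x); last first.
  by apply: eq_Rintegral => y _; rewrite mul1r.
rewrite (_ : \int[mu]_(y in _) (cst 1 y ^+ 2) = 2); last first.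
  under eq_Rintegral do rewrite /= expr1n.
  rewrite Rintegral_cst// mul1r [X in fine X]lebesgue_measure_itv/= lte_fin.
  by rewrite ifT/=; lra.
rewrite (_ : \int[mu]_(y in _) (ext f y ^+ 2) = K (fun y => f y ^+ 2) x)//.
by apply: eq_Rintegral => y _; rewrite periodic_extE [in RHS]periodic_extE.
Qed.

Lemma Kop_ge0_window : exists2 C : R, 0 <= C & forall f, measurable_fun setT f ->
  mu.-integrable (Omega L) (EFin \o f) -> (forall x, 0 <= f x) ->
  forall x, K f x <= C * \int[mu]_(y in Omega L) f y.
Proof.
have [C C0 win] := ge0_integral_window L_gt0 2; exists C => // f mf fi f0 x.
have fLI := integrable_locally_ext L_gt0 mf fi.
have := win (fun y => (f (ext id y))%:E)
  (measurable_comp_ext L_gt0 (measurable_EFin_comp mf)) _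
  (@Lperiodic_comp_ext _ _ L_gt0 _ (fun y => (f y)%:E)) (x - 1).
rewrite (_ : x - 1 + 2 = x + 1); last by ring.
rewrite (integral_Omega_ext L_gt0 (fun y => (f y)%:E)) -(EFin_Rintegral mO fi).
rewrite -lee_fin EFin_Kop// EFinM.
under [in leLHS]eq_integral => y _ do rewrite -periodic_extE.
by apply => y; rewrite lee_fin.
Qed.

Lemma Kop_sup_bound : exists2 C : R, 0 <= C & forall f, measurable_fun setT f ->
  sqint mu (Omega L) f -> forall x, K f x ^+ 2 <= C * \int[mu]_(y in Omega L) (f y ^+ 2).
Proof.
have [C C0 win] := Kop_ge0_window; exists (2 * C); first by rewrite mulr_ge0.
move=> f mf sf x; apply: le_trans (Kop_sqr_le x mf sf) _.
rewrite -mulrA ler_wpM2l//; apply: win.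
- exact: measurable_funX.
- by case: sf.
- by move=> y; exact: sqr_ge0.
Qed.

(** Fubini on the product of Omega and [-1, 1]. The domination by p x + q y covers two pairings at
    once: L^2 with L^2, through squares, and bounded with integrable functions, with p = 0. It
    survives translation in y because the integral over Omega of the extension of q is translation
    invariant. *)
Lemma Kop_fubini (sg : R) f g p q : sg = 1 \/ sg = -1 ->
  measurable_fun setT f -> measurable_fun setT p -> measurable_fun setT q ->
  mu.-integrable (Omega L) (EFin \o p) -> mu.-integrable (Omega L) (EFin \o q) ->
  (forall x, 0 <= p x) -> (forall x, 0 <= q x) ->
  (forall x y, `|f x * g y| <= p x + q y) -> LI g ->
  mu.-integrable (Omega L) (EFin \o (fun x => f x * K g x)) /\
  (\int[mu]_(x in Omega L) (f x * K g x)%:E =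
   \int[mu]_(s in `[(-1)%R, 1%R]) \int[mu]_(x in Omega L) (f x * ext g (x + sg * s))%:E)%E.
Proof.
move=> sgE mf mp mq ip iq p0 q0 fg_le gLI; have [mg gi] := gLI.
have meg := measurable_periodic_ext L_gt0 mg.
have meq := measurable_periodic_ext L_gt0 mq.
pose I : set TR := `[-1, 1]%classic; pose O : set TR := Omega L.
have mI : measurable I by exact: measurable_itv.
have mO' : measurable O by exact: mO.
(* The indicators carry both domains inside the integrand, so that Fubini applies on the full
   product space. *)
pose Phi (z : TR * TR) : \bar R :=
  (\1_O z.1 * \1_I z.2 * (f z.1 * ext g (z.1 + sg * z.2)))%:E.
have msum : measurable_fun [set: TR * TR] (fun z : TR * TR => z.1 + sg * z.2 : R).
  by apply: measurable_funD; [exact: measurable_fst|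
    apply: measurable_funM => //; exact: measurable_snd].
have mPhi : measurable_fun [set: TR * TR] Phi.
  apply/measurable_EFinP; apply: measurable_funM; apply: measurable_funM.
  - by apply: (measurableT_comp (measurable_indic mO')); exact: measurable_fst.
  - by apply: (measurableT_comp (measurable_indic mI)); exact: measurable_snd.
  - by apply: (measurableT_comp mf); exact: measurable_fst.
  - exact: (measurableT_comp meg msum).
have PhiI s x : I s ->
    Phi (x, s) = ((fun x => (f x * ext g (x + sg * s))%:E) \_ O) x.
  move=> Is; rewrite patchE /Phi/= (indicE R I) mem_set// mulr1 indicE.
  by case: (x \in O); rewrite ?mul1r ?mul0r.
have PhiNI s x : ~ I s -> Phi (x, s) = 0%E.
  by move=> Is; rewrite /Phi/= (indicE R I) memNset// mulr0 mul0r.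
have PhiO x s : O x ->
    Phi (x, s) = ((fun s => (f x * ext g (x + sg * s))%:E) \_ I) s.
  move=> Ox; rewrite patchE /Phi/= (indicE R O) mem_set// mul1r indicE.
  by case: (s \in I); rewrite ?mul1r ?mul0r.
have PhiNO x s : ~ O x -> Phi (x, s) = 0%E.
  by move=> Ox; rewrite /Phi/= (indicE R O) memNset// !mul0r.
pose M := (\int[mu]_(x in Omega L) p x + \int[mu]_(x in Omega L) q x).
have M0 : 0 <= M by rewrite addr_ge0// Rintegral_ge0.
have bound s : (\int[mu]_x `|Phi (x, s)| <= M%:E * (\1_I s)%:E)%E.
  have [Is|Is] := pselect (I s); last first.
    rewrite (eq_integral (cst 0%E)) ?integral0; last first.
      by move=> x _; rewrite PhiNI// abse0.
    by rewrite mule_ge0// lee_fin.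
  rewrite indicE mem_set// mule1.
  rewrite (eq_integral ((fun x => `|(f x * ext g (x + sg * s))%:E|%E) \_ O)); last first.
    by move=> x _; rewrite PhiI// !patchE; case: ifPn; rewrite ?abse0.
  rewrite -integral_mkcond /M EFinD !EFin_Rintegral//.
  rewrite -[X in (_ + X)%E](integral_Omega_ext L_gt0 (fun y => (q y)%:E)).
  rewrite -[X in (_ + X)%E](ge0_integral_Omega_shift L_gt0 (sg * s)); last 3 first.
  - exact: (measurable_comp_ext L_gt0 (measurable_EFin_comp mq)).
  - by move=> x; rewrite lee_fin.
  - exact: (@Lperiodic_comp_ext _ _ L_gt0 _ (fun y => (q y)%:E)).
  have mqs : measurable_fun setT (fun x : R => (q (ext id (x + sg * s)))%:E).
    apply: (@measurableT_comp _ _ _ _ _ _ (fun y : R => (q (ext id y))%:E)).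
      exact: (measurable_comp_ext L_gt0 (measurable_EFin_comp mq)).
    exact: measurable_addr.
  rewrite -ge0_integralD//; last 4 first.
  - by move=> x _; rewrite lee_fin.
  - by apply/measurable_EFinP; exact: measurable_funTS.
  - by move=> x _; rewrite lee_fin.
  - exact: measurable_funTS.
  apply: ge0_le_integral => //.
  - apply: measurableT_comp => //; apply/measurable_EFinP/measurable_funTS.
    apply: measurable_funM => //; apply: (measurableT_comp meg).
    exact: measurable_addr.
  - apply: emeasurable_funD; last exact: measurable_funTS.
    by apply/measurable_EFinP; exact: measurable_funTS.
  - by move=> x _; rewrite lee_fin periodic_extE; exact: fg_le.
have iPhi : (mu \x mu)%E.-integrable [set: TR * TR] Phi.
  apply/(integrable21ltyP mu mu mPhi).
  apply: (@le_lt_trans _ _ (\int[mu]_s (M%:E * (\1_I s)%:E))%E).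
    apply: ge0_le_integral => //.
    - by move=> s _; exact: integral_ge0.
    - have mPhi' : measurable_fun [set: TR * TR] (abse \o Phi).
        exact: measurableT_comp.
      exact: (@measurable_fun_fubini_tonelli_G _ _ TR TR R mu _ mPhi' (fun=> abse_ge0 _)).
    - apply: measurable_funeM; apply/measurable_EFinP; exact: measurable_indic.
  rewrite ge0_integralZl_EFin//; last first.
    by apply/measurable_EFinP; exact: measurable_indic.
  rewrite integral_indic// setIT [X in (_ * X)%E]lebesgue_measure_itv/= lte_fin.
  by rewrite ifT -?EFinB -?EFinM ?ltry//; lra.
have FE : fubini_F mu Phi = (fun x => (f x * K g x)%:E) \_ O.
  apply/funext => x; rewrite /fubini_F patchE; case: ifPn => [Ox|/negP Ox]; last first.
    rewrite (eq_integral (cst 0%E)) ?integral0// => s _.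
    by rewrite PhiNO// => Ox'; apply: Ox; rewrite inE.
  have /set_mem Ox' := Ox.
  have eqs : (\int[mu]_s Phi (x, s) = \int[mu]_(s in I) (f x * ext g (x + sg * s))%:E)%E.
    rewrite [RHS]integral_mkcond; apply: eq_integral => s _.
    by rewrite PhiO.
  rewrite eqs EFinM EFin_Kop//.
  have mgE : measurable_fun setT (fun y : R => (ext g y)%:E) by apply/measurable_EFinP.
  rewrite (integral_centered _ sgE mgE).
  under eq_integral => s _ do rewrite EFinM.
  rewrite integralZl//; apply/integrableP; split.
    apply/measurable_EFinP/measurable_funTS; apply: (measurableT_comp meg).
    by apply: measurable_funD => //; exact: measurable_funM.
  have := integral_centered x sgE (measurableT_comp (@abse_measurable _ setT) mgE).
  move=> /= <-; by case/integrableP : (gi (x - 1) (x + 1)).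
split.
  have := integrable_fubini_F iPhi; rewrite FE.
  by move/(integrable_mkcond _ mO').
rewrite integral_mkcond; have /= := Fubini iPhi.
rewrite -/(fubini_F mu Phi) => FF.
transitivity (\int[mu]_x fubini_F mu Phi x)%E; first by rewrite FE.
rewrite [LHS]FF [RHS]integral_mkcond; apply: eq_integral => s _.
rewrite patchE; case: ifPn => [/set_mem Is|/negP Is'].
- rewrite [RHS]integral_mkcond; apply: eq_integral => x _.
  by rewrite PhiI.
- rewrite (eq_integral (cst 0%E)) ?integral0// => x _.
  by rewrite PhiNI// => Is; apply: Is'; rewrite inE.
Qed.

(** After [Kop_fubini] with opposite signs it remains to substitute x - s for x in the integral over
    Omega, which is allowed because the extended integrand is periodic. *)
Lemma Kop_self_adjoint f g p q : measurable_fun setT p -> measurable_fun setT q ->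
  mu.-integrable (Omega L) (EFin \o p) -> mu.-integrable (Omega L) (EFin \o q) ->
  (forall x, 0 <= p x) -> (forall x, 0 <= q x) ->
  (forall x y, `|f x * g y| <= p x + q y) -> LI f -> LI g ->
  mu.-integrable (Omega L) (EFin \o (fun x => f x * K g x)) /\
  \int[mu]_(x in Omega L) (f x * K g x) = \int[mu]_(x in Omega L) (g x * K f x).
Proof.
move=> mp mq ip iq p0 q0 fg_le fLI gLI.
have [mf mg] : measurable_fun setT f /\ measurable_fun setT g.
  by case: fLI; case: gLI.
have [ifg fgE] := Kop_fubini (or_introl erefl) mf mp mq ip iq p0 q0 fg_le gLI.
have gf_le x y : `|g x * f y| <= q x + p y by rewrite mulrC addrC.
have [igf gfE] := Kop_fubini (or_intror erefl) mg mq mp iq ip q0 p0 gf_le fLI.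
split; first exact: ifg.
rewrite /Rintegral; apply: (congr1 fine); rewrite fgE gfE.
apply: eq_integral => s _; rewrite mul1r mulN1r.
transitivity (\int[mu]_(x in Omega L) (ext f x * ext g (x + s))%:E)%E.
  by apply: eq_integral => x; rewrite inE => Ox; rewrite [ext f x]periodic_ext_Omega.
rewrite -(integral_Omega_shift L_gt0 (- s) (F := fun x => (ext f x * ext g (x + s))%:E)).
- apply: eq_integral => x; rewrite inE => Ox; rewrite subrK mulrC.
  by rewrite [ext g x]periodic_ext_Omega.
- apply/measurable_EFinP; apply: measurable_funM.
    exact: measurable_periodic_ext.
  apply: (measurableT_comp (measurable_periodic_ext L_gt0 mg)).
  exact: measurable_addr.
- move=> r Lr x; rewrite (Lperiodic_ext L_gt0 f Lr) addrAC.
  by rewrite (Lperiodic_ext L_gt0 g Lr).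
Qed.

Lemma sqint_Kop f : measurable_fun setT f -> sqint mu (Omega L) f ->
  sqint mu (Omega L) (K f).
Proof.
move=> mf sf; have fLI := sqint_locally_ext L_gt0 mf sf.
have mf2 := measurable_funX 2 mf; have [_ f2] := sf.
have f2LI := integrable_locally_ext L_gt0 mf2 f2.
(* The constant 1 in the place of the first function makes K(f^2) itself integrable, and 2 K(f^2)
   dominates (K f)^2. *)
have iK : mu.-integrable (Omega L) (EFin \o (fun x => cst 1 x * K (fun y => f y ^+ 2) x)).
  have [| | | |//] := @Kop_fubini 1 (cst 1) (fun x => f x ^+ 2) (cst 0) (fun x => f x ^+ 2)
    (or_introl erefl) (measurable_cst _) (measurable_cst _) mf2 _ f2 _ _ _ f2LI.
  - by apply: (eq_integrable mO (cst 0%E)) => //; exact: integrable0.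
  - by [].
  - by move=> x; exact: sqr_ge0.
  - by move=> x y; rewrite mul1r add0r ger0_norm// sqr_ge0.
split; first by apply: measurable_funTS; exact: measurable_Kop.
apply: (le_Rintegrable mO _ _ (integrableZR mO 2 iK)).
  by apply: measurable_funTS; apply: measurable_funX; exact: measurable_Kop.
move=> x _; rewrite ger0_norm ?sqr_ge0// mul1r; exact: Kop_sqr_le.
Qed.

Lemma is_derive_Kop f x : continuous f -> Lperiodic L f ->
  is_derive x 1 (K f) (f (x + 1) - f (x - 1)).
Proof.
move=> cf pf.
rewrite (_ : K f = (fun x => \int[mu]_(y in `[x - 1, x + 1]) f y)); last first.
  by apply/funext => z; apply: eq_Rintegral => y _; rewrite periodic_ext_id.
apply: is_derive_moving_integral => // a b.
by apply: continuous_compact_integrable; [exact: segment_compact|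
  exact: continuous_subspaceT].
Qed.

End Kop.

(** * Passing between [L2] and integrals over Omega *)

Section L2_facts.
Context {R : realType} (L : \bar R).
Local Notation mu := (@lebesgue_measure R).
Local Notation TR := (measurableTypeR R).
Local Notation mO := (measurable_Omega L).
Local Notation muO := (mrestr mu mO).
Implicit Types (nu h : L2 L) (f : R -> R).

Lemma L2_measurable nu : measurable_fun setT (nu : R -> R).
Proof. by have := LfunP nu; rewrite inE => /andP[/[!inE]]. Qed.

(** [L2] is built on a restricted measure over the whole line; this converts to integrals over
    Omega, the complement being null for the restriction. *)
Lemma ge0_integral_mrestr (F : R -> \bar R) :
  measurable_fun setT F -> (forall x, 0 <= F x)%E ->
  (\int[muO]_x F x = \int[mu]_(x in Omega L) F x)%E.
Proof.
move=> mF F0.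
rewrite (@ge0_negligible_integral _ TR R muO setT (~` Omega L))//; last 2 first.
- by apply: measurableC; exact: mO.
- by rewrite -[LHS]/(mu (~` Omega L `&` Omega L)) setICl measure0.
rewrite setTD setCK; apply: eq_measure_integral => A mA AO.
by rewrite -[LHS]/(mu (A `&` Omega L)) setIidl.
Qed.

Lemma L2_norm_integral f : measurable_fun setT f ->
  ('N[muO]_2%:E[EFin \o f] `^ 2 = \int[mu]_(x in Omega L) (f x ^+ 2)%:E)%E.
Proof.
move=> mf; rewrite poweR_Lnorm//.
rewrite -(@ge0_integral_mrestr (fun x => (f x ^+ 2)%:E)); last 2 first.
- by apply/measurable_EFinP; exact: measurable_funX.
- by move=> x; rewrite lee_fin sqr_ge0.
apply: eq_integral => x _ /=.
by rewrite powR_mulrn// real_normK// num_real.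
Qed.

Lemma L2_sqint nu : sqint mu (Omega L) nu.
Proof.
have mnu := L2_measurable nu.
split; first exact: measurable_funTS.
apply/integrableP; split.
  by apply/measurable_EFinP/measurable_funTS; exact: measurable_funX.
under eq_integral => x _ do rewrite /= ger0_norm ?sqr_ge0//.
rewrite -(L2_norm_integral mnu) poweR_lty//.
exact: (@Lfunction_finite _ _ _ _ _ _ nu).
Qed.

Lemma L2norm_sqr nu : L2norm nu ^+ 2 = \int[mu]_(x in Omega L) (nu x ^+ 2).
Proof.
have [_ nu2] := L2_sqint nu.
apply: EFin_inj; rewrite (EFin_Rintegral mO nu2) -(L2_norm_integral (L2_measurable nu)).
rewrite -[X in (X `^ 2)%E]finite_norm_fine poweR_EFin powR_mulrn//.
by rewrite fine_ge0// Lnorm_ge0.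
Qed.

Lemma L2norm_ge0 nu : 0 <= L2norm nu.
Proof. by rewrite fine_ge0// Lnorm_ge0. Qed.

(** Elements of [L2] are representatives, so the equality holds at every point and not merely almost
    everywhere. *)
Lemma L2_of_fun f : measurable_fun setT f -> sqint mu (Omega L) f ->
  exists nu : L2 L, nu = f :> (R -> R).
Proof.
move=> mf [_ f2].
have fL : f \in @Lfun _ TR R muO 2%:E.
  rewrite inE; apply/andP; split; rewrite inE/=; first exact: mf.
  rewrite /finite_norm; apply: (@lty_poweRy _ _ 2) => //.
  by rewrite L2_norm_integral// -(EFin_Rintegral mO f2) ltry.
by exists (Lfun_Sub (lee1n 2) fL).
Qed.

Lemma L2valD nu h x : (nu + h : L2 L) x = nu x + h x. Proof. by []. Qed.
Lemma L2valN nu x : (- nu : L2 L) x = - nu x. Proof. by []. Qed.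
Lemma L2valZ (t : R) nu x : (t *: nu : L2 L) x = t * nu x. Proof. by []. Qed.

Lemma nbhs_L2P nu (S : set (L2 L)) :
  nbhs nu S <-> exists2 e : R, 0 < e & forall h, L2norm (nu - h) < e -> S h.
Proof. by []. Qed.

End L2_facts.

(** * Sets of positive measure and truncations *)

Section measure_facts.
Context {R : realType}.
Local Notation mu := (@lebesgue_measure R).
Local Notation TR := (measurableTypeR R).

(** Otherwise all truncations are null, and countable subadditivity makes [E] null. Boundedness is
    what makes indicators square integrable on an unbounded Omega. *)
Lemma positive_measure_bounded (E : set TR) : measurable E -> (0 < mu E)%E ->
  exists m : nat, (0 < mu (E `&` `[(- m%:R)%R, m%:R%R]%classic))%E.
Proof.
move=> mE E0; apply: contrapT => /forallNP Em0.
suff : mu E = 0 by move=> Ez; rewrite Ez ltxx in E0.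
apply/eqP; rewrite eq_le measure_ge0 andbT.
apply: (@le_trans _ _ (\sum_(n <oo) mu (E `&` `[(- n%:R)%R, n%:R%R]%classic))%E).
  apply: measure_sigma_subadditive => //; last 1 first.
  - move=> x Ex; exists (Num.truncn `|x|).+1 => //; split=> //=.
    by rewrite in_itv/= -ler_norml ltW// truncnS_gt.
  - by move=> n; apply: measurableI => //; exact: measurable_itvR.
rewrite eseries0// => n _ _; apply/eqP; rewrite eq_le measure_ge0 andbT leNgt.
exact/negP.
Qed.

Lemma sqint_bounded (D E : set TR) (M m : R) (f : R -> R) : measurable D ->
  measurable E -> E `<=` `[- m, m] -> measurable_fun setT f ->
  (forall x, E x -> `|f x| <= M) -> sqint mu D (fun x => f x * \1_E x).
Proof.
move=> mD mE Em mf fM; have mfE : measurable_fun setT (fun x : R => f x * \1_E x).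
  by apply: measurable_funM => //; exact: measurable_indic.
split; first exact: measurable_funTS.
apply/integrableP; split.
  by apply/measurable_EFinP/measurable_funTS; exact: measurable_funX.
apply: (@le_lt_trans _ _ (\int[mu]_(x in `[(- m)%R, m]) (M ^+ 2)%:E)%E); last first.
  rewrite integral_cst; last exact: measurable_itvR.
  by rewrite [X in (_ * X)%E]lebesgue_measure_itv/=; case: ifPn => _;
    rewrite ?mule0 -?EFinB -?EFinM ltry.
rewrite [leLHS]integral_mkcond [leRHS]integral_mkcond.
apply: ge0_le_integral => //.
- by move=> x _; apply: erestrict_ge0 => y _; exact: abse_ge0.
- apply/(measurable_restrictT _ _).1 => //; apply: measurableT_comp => //.
  by apply/measurable_EFinP/measurable_funTS; exact: measurable_funX.
- apply/(measurable_restrictT _ _).1 => //; exact: measurable_itvR.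
- move=> x _; rewrite !patchE; have [Ex|nEx] := pselect (E x).
    rewrite (mem_set (Em x Ex)); case: ifPn => _; last by rewrite lee_fin sqr_ge0.
    rewrite /= indicE mem_set// mulr1 lee_fin ger0_norm ?sqr_ge0//.
    rewrite -[leLHS]real_normK ?num_real// ler_sqr ?nnegrE ?fM//.
    exact: le_trans (fM x Ex).
  rewrite [X in (X <= _)%E](_ : _ = 0%E); last first.
    by case: ifPn => //= _; rewrite indicE memNset// mulr0 expr0n normr0.
  by case: ifPn => // _; rewrite lee_fin sqr_ge0.
Qed.

End measure_facts.

Section positive_integral.
Context d (T : measurableType d) (R : realType) (mu : {measure set T -> \bar R}).

Lemma Rintegral_gt0 (E : set T) (f : T -> R) : measurable E -> (0 < mu E)%E ->
  mu.-integrable E (EFin \o f) -> (forall x, E x -> 0 < f x) ->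
  0 < \int[mu]_(x in E) f x.
Proof.
move=> mE E0 fi f0; rewrite lt_neqAle Rintegral_ge0 ?andbT; last first.
  by move=> x /f0/ltW.
apply/eqP => /esym int0.
have mf : measurable_fun E (EFin \o f) by exact: measurable_int fi.
have : (\int[mu]_(x in E) `|(EFin \o f) x| = 0)%E.
  rewrite -(_ : (\int[mu]_(x in E) f x)%:E = 0%E); last by rewrite int0.
  rewrite EFin_Rintegral//; apply: eq_integral => x /set_mem Ex /=.
  by rewrite gtr0_norm// f0.
move=> /(ae_eq_integral_abs _ mE mf).1 [N [mN N0 EN]].
move: E0; rewrite ltNge => /negP; apply; rewrite -N0; apply: le_measure; rewrite ?inE//.
move=> x Ex; apply: EN => /= /(_ Ex) [fx0]; have := f0 _ Ex.
by rewrite fx0 ltxx.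
Qed.

Lemma Rintegral_negligible (D N : set T) (f : T -> R) : measurable D ->
  measurable N -> mu N = 0%E -> mu.-integrable D (EFin \o f) ->
  \int[mu]_(x in D) f x = \int[mu]_(x in D `\` N) f x.
Proof.
by move=> mD mN N0 fi; rewrite /Rintegral (negligible_integral mN mD fi N0).
Qed.

Lemma Rintegral_indic (D E : set T) (f : T -> R) : measurable D -> E `<=` D ->
  \int[mu]_(x in D) (f x * \1_E x) = \int[mu]_(x in E) f x.
Proof.
move=> mD ED; rewrite Rintegral_mkcond [RHS]Rintegral_mkcond.
apply: eq_Rintegral => x _; rewrite !patchE indicE.
case: ifPn => [/set_mem Dx|/negP Dx]; first by case: ifPn; rewrite ?mulr1 ?mulr0.
by rewrite memNset// => Ex; apply: Dx; rewrite inE; exact: ED.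
Qed.

End positive_integral.

(* Through powR, so that the junk value [0^-1 = 0] needs no case analysis. *)
Lemma measurable_invr (R : realType) : measurable_fun setT (@GRing.inv R).
Proof.
rewrite (_ : GRing.inv = fun x : R => x * (x ^+ 2) `^ (-1)).
  apply: measurable_funM => //.
  by apply: (measurableT_comp (@measurable_powR R (-1))); exact: measurable_funX.
apply/funext => x; rewrite powR_inv1 ?sqr_ge0//.
by have [->|x0] := eqVneq x 0; [rewrite mul0r invr0|field].
Qed.

(** * The dual functional *)

Section dual.
Context {R : realType} (L : \bar R) (L_gt0 : (0 < L)%E).
Variables (a u : R) (wbar : L2 L).
Local Notation mu := (@lebesgue_measure R).
Local Notation TR := (measurableTypeR R).
Local Notation mO := (measurable_Omega L).
Local Notation K := (Kop L).
Implicit Types (nu h w : L2 L) (f : R -> R) (x : R).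

Lemma measurable_preimageT f (B : set R) : measurable_fun setT f ->
  measurable B -> measurable (f @^-1` B : set TR).
Proof. by move=> mf mB; rewrite -[X in measurable X]setTI; exact: mf. Qed.

Definition Acoef nu x := a + K nu x.
Definition Bcoef nu x := nu x + u * K nu x - a * wbar x.
(** The integrand of [dual_integral] for an arbitrary function, so that it can be evaluated at
    [what], which may fail to be square integrable. *)
Definition density nu f x := f x ^+ 2 / 2 * Acoef nu x + f x * Bcoef nu x.

Lemma L2_LI nu : locally_integrable_ext L nu.
Proof. exact: (sqint_locally_ext L_gt0 (L2_measurable nu) (L2_sqint nu)). Qed.

Lemma measurable_A nu : measurable_fun setT (Acoef nu).
Proof. by apply: measurable_funD => //; apply: measurable_Kop; exact: L2_LI. Qed.

Lemma A_continuous nu : continuous (Acoef nu).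
Proof.
move=> x; apply: cvgD; first exact: cvg_cst.
by apply: Kop_continuous; exact: L2_LI.
Qed.

Lemma Lperiodic_A nu : Lperiodic L (Acoef nu).
Proof. by move=> r Lr x; rewrite /Acoef (Lperiodic_Kop L_gt0 (L2_LI nu) Lr). Qed.

Lemma Kop_bounded : exists2 C : R, 0 < C & forall nu x, `|K nu x| <= C * L2norm nu.
Proof.
(* [KC] bounds the square of [K nu x] with the factor C; C + 1 is positive and its square is at
   least C. *)
have [C C0 KC] := Kop_sup_bound L_gt0; exists (C + 1); first by rewrite ltr_wpDl.
move=> nu x; have := KC nu (L2_measurable nu) (L2_sqint nu) x.
rewrite -L2norm_sqr -[leLHS]real_normK ?num_real// => H.
rewrite -ler_sqr ?nnegrE ?mulr_ge0 ?L2norm_ge0 ?addr_ge0//.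
apply: le_trans H _; rewrite exprMn ler_wpM2r ?sqr_ge0//.
by rewrite sqrrD expr1n mulr1; nra.
Qed.

Lemma A_bounded nu : exists2 M : R, 0 <= M & forall x, `|Acoef nu x| <= M.
Proof.
have [C C0 KC] := Kop_bounded; exists (`|a| + C * L2norm nu).
  by rewrite addr_ge0// mulr_ge0 ?L2norm_ge0 ?ltW.
by move=> x; apply: le_trans (ler_normD _ _) _; rewrite lerD2l.
Qed.

Lemma L2_sqint_Kop nu : sqint mu (Omega L) (K nu).
Proof. exact: (sqint_Kop L_gt0 (L2_measurable nu) (L2_sqint nu)). Qed.

Lemma sqint_B nu : sqint mu (Omega L) (Bcoef nu).
Proof.
apply: (sqintB mO); last exact: (sqintZ mO a (L2_sqint wbar)).
by apply: (sqintD mO (L2_sqint nu)); exact: (sqintZ mO u (L2_sqint_Kop nu)).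
Qed.

Lemma measurable_B nu : measurable_fun setT (Bcoef nu).
Proof.
apply: measurable_funB; last by apply: measurable_funM => //; exact: L2_measurable.
apply: measurable_funD; first exact: L2_measurable.
by apply: measurable_funM => //; apply: measurable_Kop; exact: L2_LI.
Qed.

Lemma integrable_density nu f : sqint mu (Omega L) f ->
  mu.-integrable (Omega L) (EFin \o density nu f).
Proof.
move=> sf; apply: (integrableDR mO); last exact: (sqint_mul mO sf (sqint_B nu)).
have [M M0 AM] := A_bounded nu; have [_ f2] := sf.
have mA : measurable_fun (Omega L) (fun x => 2^-1 * Acoef nu x).
  by apply: measurable_funTS; apply: measurable_funM => //; exact: measurable_A.
have := @integrableMR _ _ _ _ _ mO (2^-1 * M) _ (fun x => f x ^+ 2) mA _ f2.
have bd x : Omega L x -> `|2^-1 * Acoef nu x| <= 2^-1 * M.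
  by move=> _; rewrite normrM ger0_norm// ler_wpM2l.
move=> /(_ bd); apply: eq_integrable; first exact: mO.
by move=> x _ /=; congr EFin; ring.
Qed.

Lemma dual_integralE nu w :
  dual_integral a u wbar nu w = (\int[mu]_(x in Omega L) density nu w x)%:E.
Proof. by rewrite (EFin_Rintegral mO (integrable_density nu (L2_sqint w))). Qed.

Lemma frakS_le nu f : measurable_fun setT f -> sqint mu (Omega L) f ->
  (frakS a u wbar nu <= (\int[mu]_(x in Omega L) density nu f x)%:E)%E.
Proof.
move=> mf sf; have [w <-] := L2_of_fun mf sf.
by rewrite -dual_integralE; apply: ereal_inf_lbound; exists w.
Qed.

Lemma frakS_ge nu (c : \bar R) :
  (forall w, c <= (\int[mu]_(x in Omega L) density nu w x)%:E)%E ->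
  (c <= frakS a u wbar nu)%E.
Proof.
by move=> H; apply: le_ereal_inf_tmp => _ [w _ <-]; rewrite dual_integralE.
Qed.

Lemma frakS_le0 nu : (frakS a u wbar nu <= 0)%E.
Proof.
have s0 : sqint mu (Omega L) (cst 0 : R -> R).
  by have := sqintZ mO 0 (L2_sqint nu); under eq_fun do rewrite mul0r.
apply: le_trans (frakS_le nu (measurable_cst _) s0) _; rewrite lee_fin.
rewrite (eq_Rintegral _ (g := cst 0)).
  by rewrite Rintegral_cst ?mul0r//; exact: mO.
by move=> x _; rewrite /density/= expr0n !mul0r addr0.
Qed.

(** The convention that the inverse of 0 is 0 absorbs the case distinction in [what]. *)
Lemma whatE nu x : what a u wbar nu x = - Bcoef nu x / Acoef nu x.
Proof.
rewrite /what -/(Acoef nu x); case: eqVneq => [->|_] /=; first by rewrite invr0 mulr0.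
by congr (_ / _); rewrite /Bcoef; ring.
Qed.

Lemma measurable_what nu : measurable_fun setT (what a u wbar nu).
Proof.
rewrite (_ : what a u wbar nu = fun x => - Bcoef nu x / Acoef nu x); last first.
  by apply/funext => x; exact: whatE.
apply: measurable_funM; first by apply: measurableT_comp => //; exact: measurable_B.
by apply: measurableT_comp (measurable_A nu); exact: measurable_invr.
Qed.

Lemma density_what nu x : density nu (what a u wbar nu) x =
  - (2^-1 * Acoef nu x * what a u wbar nu x ^+ 2).
Proof.
rewrite /density whatE; have [->|A0] := eqVneq (Acoef nu x) 0.
  by rewrite invr0 !(mulr0, mul0r) oppr0 addr0.
by field.
Qed.

(* Completing the square; where A vanishes, so does B. *)
Lemma density_ge nu f x : 0 <= Acoef nu x -> (Acoef nu x = 0 -> Bcoef nu x = 0) ->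
  - (2^-1 * Acoef nu x * what a u wbar nu x ^+ 2) <= density nu f x.
Proof.
move=> A0 AB; rewrite /density whatE; have [Az|An] := eqVneq (Acoef nu x) 0.
  by rewrite Az AB// !mulr0 mul0r oppr0 addr0.
rewrite -subr_ge0.
have -> : f x ^+ 2 / 2 * Acoef nu x + f x * Bcoef nu x -
    - (2^-1 * Acoef nu x * (- Bcoef nu x / Acoef nu x) ^+ 2) =
    2^-1 * Acoef nu x * (f x + Bcoef nu x / Acoef nu x) ^+ 2 by field.
by apply: mulr_ge0; [exact: mulr_ge0|exact: sqr_ge0].
Qed.

Lemma measurable_Nset nu : measurable (Nset a nu).
Proof.
rewrite (_ : Nset a nu = Omega L `&` Acoef nu @^-1` `]-oo, 0[%classic).
  by apply: measurableI; [exact: mO|apply: measurable_preimageT => //; exact: measurable_A].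
by apply/seteqP; split => x [Ox]; rewrite /= in_itv.
Qed.

Lemma ZsetE nu : Zset a u wbar nu =
  [set x | [/\ Omega L x, Acoef nu x = 0 & Bcoef nu x != 0]].
Proof.
apply/funext => x; rewrite /Zset /=.
suff -> : a * wbar x - nu x - u * K nu x = - Bcoef nu x by rewrite oppr_eq0.
by rewrite /Bcoef; ring.
Qed.

Lemma measurable_Zset nu : measurable (Zset a u wbar nu).
Proof.
rewrite (_ : Zset a u wbar nu = Omega L `&`
  (Acoef nu @^-1` [set 0] `&` Bcoef nu @^-1` (~` [set 0]))).
  apply: measurableI; first exact: mO.
  apply: measurableI; apply: measurable_preimageT => //.
  - exact: measurable_A.
  - exact: measurable_B.
  - exact: measurableC.
rewrite ZsetE; apply/seteqP; split => x /=.
- by move=> [Ox A0 /eqP B0].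
- by move=> [Ox [A0 B0]]; split => //; exact/eqP.
Qed.

Lemma frakS_formula nu :
  mu (Nset a nu) = 0%E -> mu (Zset a u wbar nu) = 0%E ->
  frakS a u wbar nu = (\int[mu]_(x in Omega L)
    (- (2^-1 * (a + Kop L nu x) * what a u wbar nu x ^+ 2))%:E)%E.
Proof.
move=> N0 Z0; set W := what a u wbar nu.
(* The absolute value makes [p] nonnegative everywhere, so its integral makes sense even when
   infinite; within Omega it alters the integrand only on the null set [Nset]. *)
pose p x := 2^-1 * `|Acoef nu x| * W x ^+ 2.
have p0 x : 0 <= p x by apply: mulr_ge0; [exact: mulr_ge0|exact: sqr_ge0].
have mW : measurable_fun setT W by exact: measurable_what.
have mp : measurable_fun setT p.
  apply: measurable_funM; last exact: measurable_funX.
  by apply: measurable_funM => //; apply: measurableT_comp => //; exact: measurable_A.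
have mN := measurable_Nset nu; have mZ := measurable_Zset nu.
have pE x : Omega L x -> ~ Nset a nu x -> 2^-1 * Acoef nu x * W x ^+ 2 = p x.
  move=> Ox Nx; rewrite /p ger0_norm// leNgt; apply/negP => A0.
  by apply: Nx; split.
have -> : (\int[mu]_(x in Omega L) (- (2^-1 * (a + Kop L nu x) * W x ^+ 2))%:E =
    - \int[mu]_(x in Omega L) (p x)%:E)%E.
  rewrite -integral_ge0N; last by move=> x _; rewrite lee_fin.
  apply: ae_eq_integral; first exact: mO.
  - apply/measurable_EFinP/measurable_funTS/measurableT_comp => //.
    apply: measurable_funM; last exact: measurable_funX.
    by apply: measurable_funM => //; exact: measurable_A.
  - by apply/measurable_funTS/measurableT_comp => //; exact/measurable_EFinP.
  exists (Nset a nu); split => // x /= /not_implyP[Ox] pne.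
  by apply: contrapT => Nx; apply: pne; rewrite -/(Acoef nu x) pE// EFinN.
apply/eqP; rewrite eq_le; apply/andP; split.
(* Upper bound: cutting [W] off where |W| or |x| exceeds n gives admissible functions, and the
   integrals of [p] over [E n] increase to the full one. *)
- pose E n : set TR := [set x | Omega L x /\ `|W x| <= n%:R] `&` `[- n%:R, n%:R]%classic.
  have mE n : measurable (E n).
    apply: measurableI; last exact: measurable_itvR.
    rewrite (_ : [set x | _] = Omega L `&` (fun x => `|W x|) @^-1` `]-oo, n%:R]%classic).
      apply: measurableI; first exact: mO.
      by apply: measurable_preimageT => //; exact: measurableT_comp.
    by apply/seteqP; split => x [Ox]; rewrite /= in_itv.
  have EO n : E n `<=` Omega L by move=> x [[]].
  pose f n x := W x * \1_(E n) x.
  have mf n : measurable_fun setT (f n).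
    by apply: measurable_funM; [exact: mW|exact: (measurable_indic (mE n))].
  have sf n : sqint mu (Omega L) (f n).
    apply: (@sqint_bounded _ _ _ n%:R n%:R) => //; first exact: mO.
      by move=> x [_].
    by move=> x [[_ ]].
  have fE n : (\int[mu]_(x in Omega L) density nu (f n) x)%:E =
      (- \int[mu]_(x in E n) (p x)%:E)%E.
    rewrite (EFin_Rintegral mO (integrable_density nu (sf n))).
    rewrite -integral_ge0N; last by move=> x _; rewrite lee_fin.
    rewrite [RHS]integral_mkcond (_ : E n = Omega L `&` E n); last by rewrite setIidr.
    rewrite -[RHS]integral_mkcond integral_mkcondr.
    apply: ae_eq_integral; first exact: mO.
    + by apply: measurable_int; exact: (integrable_density nu (sf n)).
    + apply: measurable_funTS; apply/(measurable_restrictT _ (mE n)).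
      by apply: measurable_funTS; apply: measurableT_comp => //; exact/measurable_EFinP.
    exists (Nset a nu); split => // x /= /not_implyP[Ox] pne.
    apply: contrapT => Nx; apply: pne; rewrite patchE.
    rewrite /f /density; case: ifPn => [|] Ex.
      rewrite !indicE Ex !mulr1 -/(density nu W x) density_what -/W pE//.
    by rewrite !indicE (negbTE Ex) !mulr0 expr0n !mul0r addr0.
  rewrite leeNr; have cvgE : (\int[mu]_(x in E i) (p x)%:E)%E @[i --> \oo] -->
      (\int[mu]_(x in Omega L) (p x)%:E)%E.
    have -> : Omega L = \bigcup_n E n.
      apply/seteqP; split => [x Ox|x [n _ [[]]]//].
      pose n := (Num.truncn (Num.max `|W x| `|x|)).+1.
      have := truncnS_gt (Num.max `|W x| `|x|); rewrite -/n gt_max => /andP[Wn xn].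
      by exists n => //; split; [split => //; exact: ltW|rewrite /= in_itv/= -ler_norml ltW].
    apply: ge0_nondecreasing_set_cvg_integral => //.
    + move=> m n mn; apply/subsetPset => x [[Ox Wx] xm]; split.
        by split => //; rewrite (le_trans Wx)// ler_nat.
      move: xm; rewrite /= !in_itv/= -!ler_norml => /le_trans; apply.
      by rewrite ler_nat.
    + by move=> n; apply/measurable_funTS; exact/measurable_EFinP.
    + by move=> n x _; rewrite lee_fin.
  rewrite -(cvg_lim _ cvgE)//; apply: lime_le; first by apply/cvg_ex; eexists; exact: cvgE.
  by apply: nearW => n; rewrite leeNr -fE; exact: frakS_le.
- apply: frakS_ge => w.
  (* Lower bound: if the integral of [p] is infinite the bound is -oo and there is nothing to prove;
     otherwise [density_ge] is integrated off the two null sets. *)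
  have := leey (\int[mu]_(x in Omega L) (p x)%:E).
  rewrite le_eqVlt => /predU1P[->|fin]; first by rewrite leNye.
  have ip : mu.-integrable (Omega L) (EFin \o p).
    apply/integrableP; split; first by apply/measurable_funTS; exact/measurable_EFinP.
    by under eq_integral => x _ do rewrite /= ger0_norm//.
  have iw := integrable_density nu (L2_sqint w).
  rewrite -(EFin_Rintegral mO ip) -EFinN lee_fin.
  have mNZ : measurable (Nset a nu `|` Zset a u wbar nu) by exact: measurableU.
  have NZ0 : mu (Nset a nu `|` Zset a u wbar nu) = 0%E.
    by apply: null_set_setU.
  rewrite (Rintegral_negligible mO mNZ NZ0 ip) (Rintegral_negligible mO mNZ NZ0 iw).
  set D := _ `\` _; have mD : measurable D by apply: measurableD => //; exact: mO.
  have DO : D `<=` Omega L by move=> x [].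
  have ipD := integrableS mO mD DO ip; have iwD := integrableS mO mD DO iw.
  rewrite -mulN1r -RintegralZl//; apply: le_Rintegral => //.
    exact: integrableZR.
  move=> x [Ox /not_orP[Nx Zx]]; rewrite mulN1r -pE//; apply: density_ge.
    by rewrite leNgt; apply/negP => A0; apply: Nx; split.
  by move=> A0; apply/eqP/negPn/negP => B0; apply: Zx; rewrite ZsetE.
Qed.

End dual.

Lemma quadratic_unbounded_below (R : realFieldType) (al be c : R) : 0 < al ->
  exists t : R, t ^+ 2 / 2 * - al + t * be <= c.
Proof.
(* The value is t (be - t al / 2). This witness has t >= 1 and t al / 2 > |be| + |c|, so the second
   factor is at most -|c|. *)
move=> al0; pose s := `|be| + `|c|; exists (2 * s / al + 1).
have s0 : 0 <= s by rewrite addr_ge0.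
have be_le : be <= `|be| by exact: ler_norm.
have c_ge : - `|c| <= c by rewrite lerNl -normrN ler_norm.
set t := _ + 1; have t1 : 1 <= t by rewrite /t lerDr divr_ge0 ?mulr_ge0// ltW.
have tal : t * al = 2 * s + al by rewrite /t; field; rewrite gt_eqF.
have -> : t ^+ 2 / 2 * - al + t * be = t * (be - (t * al) / 2) by field.
rewrite tal /s; have c0 : 0 <= `|c| by [].
by nra.
Qed.

Lemma opp_le_half (R : realFieldType) (p q : R) : 0 <= p -> - p <= q -> - p <= 2^-1 * q.
Proof. lra. Qed.

Section periodic_null.
Context {R : realType} (L : \bar R) (L_gt0 : (0 < L)%E).
Local Notation mu := (@lebesgue_measure R).
Local Notation TR := (measurableTypeR R).

(** By the window estimate for the indicator, every bounded piece of [S] has measure at most a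
    constant times that of the part of [S] in Omega. *)
Lemma periodic_null (S : set TR) : measurable S ->
  Lperiodic L (S : R -> Prop) -> mu (Omega L `&` S) = 0%E -> mu S = 0%E.
Proof.
move=> mS pS S0; apply/eqP; rewrite eq_le measure_ge0 andbT leNgt; apply/negP.
move=> /(positive_measure_bounded mS)[m]; apply/negP; rewrite -leNgt.
have [C C0 win] := ge0_integral_window L_gt0 (m%:R + m%:R).
have mI : measurable (`[- m%:R, m%:R]%classic : set TR) by exact: measurable_itvR.
pose F x : \bar R := (\1_S x)%:E.
have mF : measurable_fun setT F.
  by apply/measurable_EFinP; exact: (measurable_indic mS).
have F0 x : (0 <= F x)%E by rewrite lee_fin.
have pF : Lperiodic L F.
  move=> r Lr x; rewrite /F !indicE.
  by have -> : (x + 2 * r \in S) = (x \in S) by apply/idP/idP; rewrite !inE (pS _ Lr).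
have := win F mF F0 pF (- m%:R); rewrite addKr /F.
rewrite !integral_indic//; last exact: measurable_Omega.
by rewrite [X in (_ * X)%E](_ : _ = 0%E) ?mule0// setIC; exact: S0.
Qed.

End periodic_null.

(** * The domain, concavity and semicontinuity of the dual functional *)

Section interior.
Context {R : realType} (L : \bar R) (L_gt0 : (0 < L)%E).
Variables (a u : R) (wbar : L2 L).
Local Notation mu := (@lebesgue_measure R).
Local Notation TR := (measurableTypeR R).
Local Notation mO := (measurable_Omega L).
Local Notation K := (Kop L).
Local Notation S := (frakS a u wbar).
Local Notation A := (Acoef a).
Local Notation B := (Bcoef a u wbar).
Local Notation density := (density a u wbar).
Local Notation "'I' f" := (\int[mu]_(x in Omega L) f x) (at level 10, f at level 9).
Implicit Types (nu h w : L2 L) (f : R -> R) (x : R).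

Lemma frakS_Ny nu :
  (forall c : R, exists f, [/\ measurable_fun setT f, sqint mu (Omega L) f &
    I (density nu f) <= c]) -> S nu = -oo%E.
Proof.
move=> H; apply: eq_ninfty => c; have [f [mf sf fc]] := H c.
by apply: le_trans (frakS_le L_gt0 a u wbar nu mf sf) _; rewrite lee_fin.
Qed.

(** Along multiples of the indicator of a bounded part of [Nset], the functional is a quadratic
    polynomial with negative leading coefficient. *)
Lemma frakS_Nset nu : (0 < mu (Nset a nu))%E -> S nu = -oo%E.
Proof.
have mN := measurable_Nset L_gt0 a nu.
move=> /(positive_measure_bounded mN)[m]; set E := (X in mu X) => E0.
have mE : measurable E by apply: measurableI => //; exact: measurable_itvR.
have EO : E `<=` Omega L by move=> x [[]].
have sE (t : R) : sqint mu (Omega L) (fun x => t * \1_E x).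
  apply: (@sqint_bounded _ _ _ `|t| m%:R (cst t)) => //; first exact: mO.
  by move=> x [].
have mtE (t : R) : measurable_fun setT (fun x : R => t * \1_E x).
  by apply: measurable_funM => //; exact: (measurable_indic mE).
have sE1 : sqint mu (Omega L) (\1_E : R -> R).
  by have := sE 1; under eq_fun do rewrite mul1r.
have ind2 x : \1_E x * \1_E x = \1_E x :> R by rewrite !indicE; case: (x \in E); rewrite ?mulr1 ?mulr0.
have restr f : mu.-integrable (Omega L) (EFin \o (fun x => f x * \1_E x)) ->
    mu.-integrable E (EFin \o f).
  move=> /(integrableS mO mE EO); apply: eq_integrable => // x xE /=.
  by rewrite indicE xE mulr1.
have iA : mu.-integrable E (EFin \o A nu).
  apply: restr; have [M M0 AM] := A_bounded L_gt0 a nu.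
  have mA := measurable_funTS (measurable_A L_gt0 a nu) : measurable_fun (Omega L) (A nu).
  have := integrableMR mO mA (fun x _ => AM x) (sqint_mul mO sE1 sE1).
  by apply: eq_integrable => [|x _ /=]; [exact: mO|rewrite ind2].
have iB : mu.-integrable E (EFin \o B nu).
  by apply: restr; exact: (sqint_mul mO (sqint_B L_gt0 a u wbar nu) sE1).
have A0 : 0 < \int[mu]_(x in E) - A nu x.
  apply: Rintegral_gt0 => //; last by move=> x [[_ Ax] _]; rewrite oppr_gt0.
  by have := integrableZR mE (-1) iA; under eq_fun do rewrite mulN1r.
apply: frakS_Ny => c.
have [t tc] := quadratic_unbounded_below (\int[mu]_(x in E) B nu x) c A0.
exists (fun x => t * \1_E x); split => //; apply: le_trans tc.
have -> : \int[mu]_(x in E) - A nu x = - \int[mu]_(x in E) A nu x.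
  by under eq_Rintegral do rewrite -mulN1r; rewrite RintegralZl// mulN1r.
rewrite opprK.
have -> : I (density nu (fun x => t * \1_E x)) =
    \int[mu]_(x in E) (t ^+ 2 / 2 * A nu x + t * B nu x).
  rewrite -(Rintegral_indic mu _ mO EO); apply: eq_Rintegral => x _.
  rewrite /density exprMn (_ : \1_E x ^+ 2 = \1_E x); [ring|exact: ind2].
rewrite RintegralD//; do ?exact: integrableZR.
by rewrite !RintegralZl.
Qed.

(** Where A = 0 the functional is linear in w, so it is tested against negative multiples of B,
    whose restriction to [Zset] is square integrable. *)
Lemma frakS_Zset nu : (0 < mu (Zset a u wbar nu))%E -> S nu = -oo%E.
Proof.
have mZ := measurable_Zset L_gt0 a u wbar nu.
have ZE := ZsetE a u wbar nu.
set E := Zset _ _ _ _ in mZ ZE *; move=> E0.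
have EO : E `<=` Omega L by rewrite ZE => x [].
have sB := sqint_B L_gt0 a u wbar nu; have mB := measurable_B L_gt0 a u wbar nu.
have iB2 : mu.-integrable E (EFin \o (fun x => B nu x ^+ 2)).
  by apply: (integrableS mO mZ EO); case: sB.
have g0 : 0 < \int[mu]_(x in E) (B nu x ^+ 2).
  by apply: Rintegral_gt0 => // x; rewrite ZE => -[_ _ B0]; rewrite exprn_even_gt0.
apply: frakS_Ny => c; set g := \int[mu]_(x in E) _ in g0.
(* The factor makes the integral exactly -|c|. *)
exists (fun x => - (`|c| / g) * (\1_E x * B nu x)); split.
- by apply: measurable_funM => //; apply: measurable_funM => //; exact: (measurable_indic mZ).
- apply: (sqintZ mO); apply: (@sqintMb _ _ _ _ _ mO 1) => // x _.
  by rewrite ger0_norm ?indicE//; case: (_ \in _).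
have -> : I (density nu (fun x => - (`|c| / g) * (\1_E x * B nu x))) = - `|c|.
  transitivity (\int[mu]_(x in E) (- (`|c| / g) * B nu x ^+ 2)); last first.
    by rewrite RintegralZl// -/g mulNr divfK ?gt_eqF.
  rewrite -(Rintegral_indic mu _ mO EO); apply: eq_Rintegral => x _.
  rewrite /density !indicE; case: (boolP (x \in E)) => Ex; last first.
    by rewrite !(mulr0, mul0r) expr0n !mul0r addr0.
  have : E x by rewrite -in_setE.
  by rewrite ZE => -[_ -> _]; rewrite /=; ring.
by rewrite lerNl -normrN; exact: ler_norm.
Qed.

Lemma KopB nu h x : K (nu - h : L2 L) x = K nu x - K h x.
Proof.
have := KopD 1 (-1) x (L2_LI L_gt0 nu) (L2_LI L_gt0 h); rewrite mul1r mulN1r => <-.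
by congr Kop; apply/funext => y; rewrite mul1r mulN1r.
Qed.

Lemma KopDZ nu h (t s : R) x : K (t *: nu + s *: h : L2 L) x = t * K nu x + s * K h x.
Proof. by rewrite -(KopD t s x (L2_LI L_gt0 nu) (L2_LI L_gt0 h)). Qed.

(** For fixed w the integral is affine in nu, so both values of S are estimated with the same w. *)
Lemma frakS_concave : concave S.
Proof.
move=> nu nu' t /andP[t0 t1]; apply: (frakS_ge L_gt0) => w.
have sw := L2_sqint w; have id := integrable_density L_gt0 a u wbar.
have -> : I (density (t *: nu + (1 - t) *: nu' : L2 L) w) =
    t * I (density nu w) + (1 - t) * I (density nu' w).
  rewrite -(RintegralZl t mO (id nu w sw)) -(RintegralZl (1 - t) mO (id nu' w sw)).
  rewrite -(RintegralD mO (integrableZR mO t (id nu w sw))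
    (integrableZR mO (1 - t) (id nu' w sw))).
  apply: eq_Rintegral => x _; rewrite /density /Acoef /Bcoef !KopDZ !L2valD !L2valZ.
  by ring.
rewrite [leRHS]EFinD !EFinM; apply: leeD; apply: lee_wpmul2l; rewrite ?lee_fin.
- exact: ltW.
- exact: (frakS_le L_gt0 a u wbar nu (L2_measurable w)).
- by rewrite subr_ge0 ltW.
- exact: (frakS_le L_gt0 a u wbar nu' (L2_measurable w)).
Qed.

(** Cauchy-Schwarz with the square root of an integral G weakened to 1 + G, which is enough for
    continuity. *)
Lemma L2_pairing_bound h f : sqint mu (Omega L) f ->
  `|I (fun x => h x * f x)| <= L2norm h * (1 + I (fun x => f x ^+ 2)).
Proof.
move=> sf; have := cauchy_schwarz_Rintegral mO (L2_sqint h) sf.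
rewrite -L2norm_sqr; set P := \int[mu]_(x in Omega L) (h x * f x).
set G := \int[mu]_(x in Omega L) (f x ^+ 2) => PG.
have G0 : 0 <= G by exact: Rintegral_sqr_ge0.
have n0 := L2norm_ge0 h.
rewrite -ler_sqr ?nnegrE ?mulr_ge0 ?addr_ge0// real_normK ?num_real//.
by apply: le_trans PG _; rewrite exprMn ler_wpM2l ?sqr_ge0//; nra.
Qed.

(** The difference splits into the pairings of K h with w^2 / 2, of h with w, and of u K h with w.
    The sup bound on K h controls the first, Cauchy-Schwarz the second, and self-adjointness turns
    the third into a pairing of h with u K w. *)
Lemma density_difference_bound w : exists2 C : R, 0 < C & forall nu nu',
  I (density nu' w) <= I (density nu w) + C * L2norm (nu - nu').
Proof.
have [C C0 KC] := Kop_bounded L_gt0.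
have sw := L2_sqint w; have mw := L2_measurable w; have [_ w2] := sw.
have sKw := L2_sqint_Kop L_gt0 w.
exists (C * I (fun x => w x ^+ 2) + (1 + I (fun x => w x ^+ 2)) +
   `|u| * (1 + I (fun x => K w x ^+ 2))).
  have := Rintegral_sqr_ge0 mu (Omega L) w; have := Rintegral_sqr_ge0 mu (Omega L) (K w).
  move=> k0 w0; apply: ltr_wpDr; first by rewrite mulr_ge0// addr_ge0.
  by apply: ltr_wpDl; [rewrite mulr_ge0// ltW|rewrite ltr_pwDl].
move=> nu nu'; set h := nu - nu'; set n := L2norm h.
have n0 : 0 <= n := L2norm_ge0 h.
have sh := L2_sqint h; have mh := L2_measurable h; have [_ h2] := sh.
have sKh := L2_sqint_Kop L_gt0 h.
have id nu0 := integrable_density L_gt0 a u wbar nu0 sw.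
have [iwKh wKhE] : mu.-integrable (Omega L) (EFin \o (fun x => w x * K h x)) /\
    I (fun x => w x * K h x) = I (fun x => h x * K w x).
  apply: (@Kop_self_adjoint _ _ L_gt0 _ _ (fun x => w x ^+ 2) (fun x => h x ^+ 2)) => //.
  - exact: measurable_funX.
  - exact: measurable_funX.
  - by move=> x; exact: sqr_ge0.
  - by move=> x; exact: sqr_ge0.
  - by move=> x y; exact: norm_mul_le_sqrD.
  - exact: (L2_LI L_gt0 w).
  - exact: (L2_LI L_gt0 h).
have iwh := sqint_mul mO sh sw.
have iw2K : mu.-integrable (Omega L) (EFin \o (fun x => K h x * w x ^+ 2)).
  have mK : measurable_fun (Omega L) (K h) by case: sKh.
  exact: (integrableMR mO mK (fun x _ => KC h x) w2).
have split_diff : I (density nu w) - I (density nu' w) =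
    2^-1 * I (fun x => K h x * w x ^+ 2) + I (fun x => h x * w x) +
    u * I (fun x => w x * K h x).
  rewrite -(RintegralB mO (id nu) (id nu')).
  rewrite -(RintegralZl 2^-1 mO iw2K) -(RintegralZl u mO iwKh).
  have i1 := integrableZR mO 2^-1 iw2K; have i2 := integrableZR mO u iwKh.
  have i3 := integrableDR mO i1 iwh.
  rewrite -(RintegralD mO i1 iwh) -(RintegralD mO i3 i2).
  apply: eq_Rintegral => x _.
  by rewrite /density /Acoef /Bcoef /h !KopB !L2valD !L2valN; field.
rewrite -lerBlDl -opprB lerNl split_diff.
have b1 : - (C * n * I (fun x => w x ^+ 2)) <= 2^-1 * I (fun x => K h x * w x ^+ 2).
  rewrite -mulNr -(RintegralZl _ mO w2) -(RintegralZl _ mO iw2K).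
  apply: (le_Rintegral mO).
  - exact: (integrableZR mO _ w2).
  - exact: (integrableZR mO _ iw2K).
  move=> x _; have := KC h x; rewrite -/n ler_norml => /andP[k1 k2].
  have w0 := sqr_ge0 (w x); have Cn : 0 <= C * n by rewrite mulr_ge0// ltW.
  by rewrite mulrA ler_wpM2r// opp_le_half.
have b2 : - (n * (1 + I (fun x => w x ^+ 2))) <= I (fun x => h x * w x).
  by have := L2_pairing_bound h sw; rewrite ler_norml => /andP[].
have b3 : - (n * (`|u| * (1 + I (fun x => K w x ^+ 2)))) <= u * I (fun x => w x * K h x).
  rewrite wKhE mulrCA lerNl; apply: le_trans (ler_norm _) _; rewrite normrN normrM.
  by apply: ler_wpM2l; [exact: normr_ge0|exact: (L2_pairing_bound h sKw)].
rewrite [- _](_ : _ = - (C * n * I (fun x => w x ^+ 2)) +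
  - (n * (1 + I (fun x => w x ^+ 2))) +
  - (n * (`|u| * (1 + I (fun x => K w x ^+ 2))))); last by ring.
by rewrite !lerD.
Qed.

Lemma frakS_usc : upper_semicontinuous S.
Proof.
move=> nu c /ereal_inf_lt[_ [w _ <-]]; rewrite (dual_integralE L_gt0) lte_fin => Dc.
have [C C0 DC] := density_difference_bound w.
(* Within this radius the linear bound keeps the integral for the same [w] below [c]. *)
exists [set nu' | L2norm (nu - nu') < (c - I (density nu w)) / C].
  by apply/nbhs_L2P; exists ((c - I (density nu w)) / C) => //; rewrite divr_gt0 ?subr_gt0.
move=> nu' /=; rewrite ltr_pdivlMr// ltrBrDl mulrC => H.
apply: le_lt_trans (frakS_le L_gt0 a u wbar nu' (L2_measurable w) (L2_sqint w)) _.
by rewrite lte_fin; apply: le_lt_trans (DC nu nu') _.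
Qed.

(** Replacing A by its lower bound [d] and completing the square gives -B^2 / (2 d) as a pointwise
    bound. *)
Lemma frakS_lower_bound nu (d : R) : 0 < d -> (forall x, d <= A nu x) ->
  ((- ((2 * d)^-1 * I (fun x => B nu x ^+ 2)))%:E <= S nu)%E.
Proof.
move=> d0 dA; apply: (frakS_ge L_gt0) => w; rewrite lee_fin.
have [_ B2] := sqint_B L_gt0 a u wbar nu.
rewrite -mulNr -(RintegralZl _ mO B2); apply: (le_Rintegral mO).
- exact: (integrableZR mO _ B2).
- exact: (integrable_density L_gt0 a u wbar nu (L2_sqint w)).
move=> x _; rewrite /density -subr_ge0.
have -> : w x ^+ 2 / 2 * A nu x + w x * B nu x - - (2 * d)^-1 * B nu x ^+ 2 =
    w x ^+ 2 / 2 * (A nu x - d) + d / 2 * (w x + B nu x / d) ^+ 2.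
  by field; rewrite gt_eqF.
by rewrite addr_ge0// mulr_ge0 ?sqr_ge0 ?divr_ge0 ?sqr_ge0 ?subr_ge0// ltW.
Qed.

Hypothesis a_gt0 : 0 < a.

(** Nearly all the mass of nu^2 sits in some [-n, n]; a window disjoint from it carries little, so
    |K nu| <= a / 2 there. *)
Lemma Acoef_tail nu : L = +oo%E -> exists m : nat, forall x, m%:R < `|x| ->
  a / 2 <= A nu x.
Proof.
move=> Ly; have [mnu [_ nu2]] := (L2_measurable nu, L2_sqint nu).
pose p x : \bar R := (nu x ^+ 2)%:E.
have mp : measurable_fun setT p by apply/measurable_EFinP; exact: measurable_funX.
have p0 x : (0 <= p x)%E by rewrite lee_fin sqr_ge0.
have OT : Omega L = setT by rewrite Ly OmegaT.
pose J (n : nat) : set TR := `[- n%:R, n%:R]%classic.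
have cvgJ : (\int[mu]_(x in J i) p x)%E @[i --> \oo] --> (\int[mu]_x p x)%E.
  have -> : [set: TR] = \bigcup_n J n.
    apply/seteqP; split => // x _; exists (Num.truncn `|x|).+1 => //.
    by rewrite /J/= in_itv/= -ler_norml ltW// truncnS_gt.
  apply: ge0_nondecreasing_set_cvg_integral => //.
  - move=> m n mn; apply/subsetPset => x; rewrite /J/= !in_itv/= -!ler_norml => /le_trans.
    by apply; rewrite ler_nat.
  - by move=> n; exact: measurable_itvR.
  - by move=> n; exact: measurable_funTS.
pose P := I (fun x => nu x ^+ 2).
have PE : (\int[mu]_x p x)%E = P%:E by rewrite (EFin_Rintegral mO nu2) OT.
(* Chosen so that 2 e = (a / 2)^2, the factor 2 coming from [Kop_sqr_le]. *)
pose e := a ^+ 2 / 8.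
have e0 : 0 < e by rewrite divr_gt0// exprn_gt0.
have [n Jn] : exists n, ((P - e)%:E < \int[mu]_(x in J n) p x)%E.
  apply: contrapT => /forallNP H.
  have : (\int[mu]_x p x <= (P - e)%:E)%E.
    rewrite -(cvg_lim _ cvgJ)//; apply: lime_le; first by apply/cvg_ex; eexists; exact: cvgJ.
    by apply: nearW => n; rewrite leNgt; exact/negP.
  by rewrite PE lee_fin lerBrDr gerDl leNgt e0.
(* One more than [n], because the window around [x] has radius 1 and must avoid [-n, n]. *)
exists n.+1 => x nx; rewrite /Acoef.
suff : K nu x ^+ 2 <= (a / 2) ^+ 2.
  move=> H; have : `|K nu x| <= a / 2.
    by rewrite -ler_sqr ?nnegrE ?real_normK ?num_real// ltW ?divr_gt0.
  by rewrite ler_norml => /andP[]; lra.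
apply: le_trans (Kop_sqr_le L_gt0 x mnu (L2_sqint nu)) _.
rewrite (_ : (a / 2) ^+ 2 = 2 * e); last by rewrite /e; field.
rewrite ler_wpM2l// -lee_fin EFin_Kop//; last first.
  by apply: integrable_locally_ext => //; exact: measurable_funX.
pose X : set TR := `[x - 1, x + 1]%classic.
have -> : (\int[mu]_(y in `[(x - 1)%R, (x + 1)%R]) (periodic_ext L (fun y => nu y ^+ 2) y)%:E =
    \int[mu]_(y in X) p y)%E.
  by apply: eq_integral => y _; rewrite (periodic_ext_Omega L_gt0)// OT.
have mX : measurable X by exact: measurable_itvR.
have mJ : measurable (J n) by exact: measurable_itvR.
have dJX : [disjoint J n & X].
  apply/disj_setPS => y []; rewrite /J /X /= !in_itv/= -ler_norml => yn /andP[y1 y2].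
  have : `|x| <= n%:R + 1.
    rewrite (_ : x = y + (x - y)); last by ring.
    apply: le_trans (ler_normD _ _) _; rewrite lerD// ler_norml; apply/andP; split; lra.
  by rewrite natr1 leNgt nx.
have : (\int[mu]_(y in J n `|` X) p y <= \int[mu]_y p y)%E.
  by apply: ge0_subset_integral => //; exact: measurableU.
rewrite PE ge0_integral_setU//; last exact: measurable_funTS.
have fin : (\int[mu]_(x0 in X) p x0)%E \is a fin_num.
  rewrite ge0_fin_numE ?integral_ge0//; apply: (@le_lt_trans _ _ P%:E); last exact: ltry.
  by rewrite -PE; exact: ge0_subset_integral.
rewrite -(fineK fin) => H.
have : ((P - e)%:E + (fine (\int[mu]_(x0 in X) p x0))%:E <= P%:E)%E.
  by apply: le_trans H; rewrite leeD2r// ltW.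
by rewrite -EFinD !lee_fin; lra.
Qed.

(** Reduces a lower bound for A on the line to one on a compact interval: by periodicity for finite
    L, by the tail bound otherwise. *)
Lemma A_reduce nu : exists2 M : R, 0 <= M & forall x, a / 2 <= A nu x \/
  exists2 y, y \in `[- M, M] & A nu x = A nu y.
Proof.
have [[r r0 LE]|LE] : (exists2 r : R, 0 < r & L = r%:E) \/ L = +oo%E.
  clear -L_gt0; case: L L_gt0 => [r|_|//]; last by right.
  by rewrite lte_fin; left; exists r.
- exists r; first exact: ltW.
  move=> x; right; exists (periodic_ext L id x).
    rewrite /periodic_ext LE in_itv/=.
    have r20 : 0 < 2 * r by rewrite mulr_gt0.
    have fl := floor_le ((x + r) / (2 * r)); have fu := floorD1_gt ((x + r) / (2 * r)).
    set m := Num.floor _ in fl fu *; rewrite ler_pdivlMr// in fl.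
    rewrite intrD ltr_pdivrMr// in fu.
    by apply/andP; split; nra.
  by rewrite -periodic_extE periodic_ext_id//; exact: Lperiodic_A.
- have [m mA] := Acoef_tail nu LE; exists m%:R => // x.
  have [xm|mx] := leP `|x| m%:R; last by left; exact: mA.
  by right; exists x => //; rewrite in_itv/= -ler_norml.
Qed.

Lemma A_uniformly_positive nu : (forall x, 0 < A nu x) ->
  exists2 d : R, 0 < d & forall x, d <= A nu x.
Proof.
move=> A0; have [M M0 AM] := A_reduce nu.
have MM : - M <= M by lra.
have [c _ cmin] := EVT_min MM (continuous_subspaceT (@A_continuous _ _ L_gt0 a nu)).
exists (Num.min (a / 2) (A nu c)); first by rewrite lt_min A0 divr_gt0.
move=> x; rewrite ge_min; have [->//|[y yM ->]] := AM x.
by rewrite cmin ?orbT.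
Qed.

Lemma frakS_interior : (dom S)^° = [set nu | forall x, 0 < a + K nu x].
Proof.
apply/seteqP; split => nu /=.
- rewrite /interior => /nbhs_L2P[e e0 edom] x0; rewrite ltNge; apply/negP => Ax0.
  (* [J] contains the window around [x0], also after folding, so K of its indicator equals 2 at
     [x0]. *)
  pose M := `|x0| + 1; pose J : set TR := `[- M, M]%classic.
  have mJ : measurable J by exact: measurable_itvR.
  have mphi : measurable_fun setT (\1_J : R -> R) by exact: (measurable_indic mJ).
  have sphi : sqint mu (Omega L) (\1_J : R -> R).
    rewrite (_ : \1_J = fun x : TR => cst 1 x * \1_J x); last first.
      by apply/funext => x; rewrite /cst mul1r.
    by apply: (sqint_bounded (M := 1) mO mJ (@subset_refl _ _)) => // x _; rewrite normr1.
  have [phi phiE] := L2_of_fun mphi sphi.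
  have Kphi : K phi x0 = 2.
    rewrite /Kop (eq_Rintegral _ (g := cst 1)).
      rewrite Rintegral_cst; last exact: measurable_itvR.
      by rewrite mul1r [X in fine X]lebesgue_measure_itv/= lte_fin ifT/=; lra.
    move=> y; rewrite inE/= in_itv/= => /andP[y1 y2].
    rewrite periodic_extE phiE indicE mem_set// /J/= in_itv/= -ler_norml.
    apply: le_trans (norm_periodic_ext_id L_gt0 y) _.
    rewrite /M (_ : y = x0 + (y - x0)); last by ring.
    by apply: le_trans (ler_normD _ _) _; rewrite lerD2l ler_norml; apply/andP; split; lra.
  have n0 := L2norm_ge0 phi.
  have [t t0 tn] : exists2 t, 0 < t & t * L2norm phi < e.
    exists (e / (2 * (L2norm phi + 1))); first by rewrite divr_gt0// mulr_gt0// ltr_wpDl.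
    rewrite mulrAC ltr_pdivrMr; last by rewrite mulr_gt0// ltr_wpDl.
    by rewrite ltr_pM2l//; lra.
  have tn0 : 0 <= t * L2norm phi by rewrite mulr_ge0// ltW.
  pose h : L2 L := nu - t *: phi.
  have Kh x : K h x = K nu x - t * K phi x.
    by have := KopDZ nu phi 1 (- t) x; rewrite scale1r scaleNr mul1r mulNr.
  have : dom S h.
    apply: edom; rewrite /h opprB addrCA subrr addr0.
    rewrite -(@ltr_pXn2r _ 2)// ?nnegrE ?L2norm_ge0 ?(ltW e0)// L2norm_sqr.
    under eq_Rintegral do rewrite L2valZ exprMn.
    rewrite RintegralZl; [|exact: mO|by case: (L2_sqint phi)].
    by rewrite -L2norm_sqr -exprMn ltr_pXn2r ?nnegrE ?(ltW e0).
  rewrite /dom/= frakS_Nset//.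
  pose N : set TR := [set x | A h x < 0].
  have mN : measurable N.
    rewrite (_ : N = A h @^-1` `]-oo, 0[%classic).
      by apply: measurable_preimageT => //; exact: measurable_A.
    by apply/seteqP; split=> x; rewrite /N /= in_itv.
  have Ah0 : A h x0 < 0 by rewrite /Acoef Kh Kphi; lra.
  have oN : nbhs x0 N.
    by have := @A_continuous _ _ L_gt0 a h x0; move/cvgr_lt; exact.
  (* The point [x0] may lie outside Omega. If [Nset] were null, periodicity would make [N] null on
     the whole line, although it contains a ball around [x0]. *)
  rewrite lt_neqAle measure_ge0 andbT; apply/eqP => NO.
  have N0 : mu N = 0%E.
    apply: (periodic_null L_gt0 mN); last by rewrite NO.
    by move=> r Lr x; rewrite /N/= (Lperiodic_A L_gt0 a h Lr).
  have [r /= r0 rN] := oN.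
  have : (mu (ball x0 r) <= mu N)%E.
    by apply: le_measure; rewrite ?inE//; exact: measurable_ball.
  rewrite N0 leNgt; have -> : mu (ball x0 r) = (r *+ 2)%:E.
    by apply: lebesgue_measure_ball; exact: ltW.
  by rewrite lte_fin -mulr_natr mulr_gt0.
- move=> A0; have [d d0 dA] := A_uniformly_positive A0.
  have [C C0 KC] := Kop_bounded L_gt0.
  (* Within this radius [K] changes by at most d / 2, so A stays at least d / 2. *)
  apply/nbhs_L2P; exists (d / (2 * C)); first by rewrite divr_gt0// mulr_gt0.
  move=> h; rewrite ltr_pdivlMr ?mulr_gt0// => hd.
  have Ah x : d / 2 <= A h x.
    have := KC (nu - h) x; have := dA x; rewrite KopB ler_norml /Acoef.
    by move=> d1 /andP[k1 k2]; nra.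
  have d20 : 0 < d / 2 by rewrite divr_gt0.
  by apply: lt_le_trans (frakS_lower_bound d20 Ah); exact: ltNyr.
Qed.

End interior.

(** * Existence of a maximizer *)

Section L2_geometry.
Context {R : realType} (L : \bar R).
Local Notation mu := (@lebesgue_measure R).
Local Notation mO := (measurable_Omega L).
Implicit Types (nu h : L2 L).

(** The midpoint is written with the weights of [concave] at t = 1/2, to fit [frakS_concave]. *)
Lemma L2_parallelogram nu h : L2norm (nu - h) ^+ 2 =
  2 * L2norm nu ^+ 2 + 2 * L2norm h ^+ 2 -
  4 * L2norm (2^-1 *: nu + (1 - 2^-1) *: h) ^+ 2.
Proof.
have sn := L2_sqint nu; have sh := L2_sqint h.
rewrite !L2norm_sqr.
have e1 := Rintegral_sqrD mO (-1) sn sh; have e2 := Rintegral_sqrD mO 1 sn sh.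
have -> : \int[mu]_(x in Omega L) ((nu - h) x ^+ 2) =
    \int[mu]_(x in Omega L) ((nu x + -1 * h x) ^+ 2).
  by apply: eq_Rintegral => x _; rewrite mulN1r.
have -> : \int[mu]_(x in Omega L) ((2^-1 *: nu + (1 - 2^-1) *: h) x ^+ 2) =
    4^-1 * \int[mu]_(x in Omega L) ((nu x + 1 * h x) ^+ 2).
  have [_ i2] := sqintD mO sn (sqintZ mO 1 sh).
  rewrite -(RintegralZl _ mO i2); apply: eq_Rintegral => x _.
  change ((2^-1 * nu x + (1 - 2^-1) * h x) ^+ 2 = 4^-1 * (nu x + 1 * h x) ^+ 2).
  by field.
by rewrite e1 e2; field.
Qed.

Lemma L2_complete (f : nat -> L2 L) :
  (forall n, L2norm (f n.+1 - f n) ^+ 2 <= 8^-1 ^+ n) ->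
  exists (nu : L2 L) (C : R), forall n, L2norm (nu - f n) ^+ 2 <= C * 4^-1 ^+ n.
Proof.
move=> fast.
have [|g [mg sg [C gC]]] := riesz_fischer_fast mO (fun n => L2_measurable (f n))
  (fun n => L2_sqint (f n)).
  move=> n; apply: le_trans (fast n); rewrite L2norm_sqr le_eqVlt; apply/orP; left.
  by apply/eqP; apply: eq_Rintegral.
have [nu nuE] := L2_of_fun mg sg; exists nu, C => n.
apply: le_trans (gC n); rewrite L2norm_sqr le_eqVlt; apply/orP; left.
by apply/eqP; apply: eq_Rintegral => x _; rewrite -nuE -sqrrN opprB.
Qed.

End L2_geometry.

Section maximizer.
Context {R : realType} (L : \bar R) (L_gt0 : (0 < L)%E).
Variables (a u : R) (a_gt0 : 0 < a) (wbar : L2 L).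
Local Notation S := (frakS a u wbar).
Implicit Types (nu h w : L2 L).

(** At nu = 0 the coefficient A is the constant a. This keeps the supremum of S finite. *)
Lemma frakS0_gtNy : (-oo < S (0%R : L2 L))%E.
Proof.
have [C C0 KC] := Kop_bounded L_gt0.
have dA x : a <= Acoef a (0%R : L2 L) x.
  have := KC 0 x; rewrite L2norm0 mulr0 normr_le0 => /eqP K0.
  by rewrite /Acoef K0 addr0.
by apply: lt_le_trans (frakS_lower_bound L_gt0 u wbar a_gt0 dA); exact: ltNyr.
Qed.

(* Near-minimal norm elements of the superlevel sets [m - e_n <= S], which are
   convex and decreasing, form a Cauchy sequence by the parallelogram law. *)
Lemma maximizing_sequence (m r : R) :
  (forall e : R, 0 < e -> exists nu, ((m - e)%:E <= S nu)%E) ->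
  (forall nu, ((m - 1)%:E <= S nu)%E -> L2norm nu <= r) ->
  exists f : nat -> L2 L, forall n,
    ((m - 8^-1 ^+ n)%:E <= S (f n))%E /\ L2norm (f n.+1 - f n) ^+ 2 <= 8^-1 ^+ n.
Proof.
move=> approach bounded.
pose e (n : nat) : R := n.+1%:R^-1.
have e0 n : 0 < e n by rewrite invr_gt0.
have e1 n : e n <= 1 by rewrite invf_le1// ler1n.
have eD n k : (n <= k)%N -> e k <= e n by move=> nk; rewrite lef_pV2 ?posrE// ler_nat.
pose C n := [set nu | ((m - e n)%:E <= S nu)%E].
have Csub n k : (n <= k)%N -> C k `<=` C n.
  by move=> nk nu; apply: le_trans; rewrite lee_fin lerD2l lerN2 eD.
pose Q n := [set L2norm nu ^+ 2 | nu in C n].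
have Qinf n : has_inf (Q n).
  split; first by have [nu nuC] := approach _ (e0 n); exists (L2norm nu ^+ 2), nu.
  by exists 0 => _ [nu _ <-]; exact: sqr_ge0.
pose d n := inf (Q n).
have dC n nu : C n nu -> d n <= L2norm nu ^+ 2.
  by move=> nuC; apply: ge_inf; [case: (Qinf n)|exists nu].
have near_min n : {nu | C n nu /\ L2norm nu ^+ 2 < d n + e n}.
  apply: cid; have [_ [nu nuC <-] H] := inf_adherent (e0 n) (Qinf n).
  by exists nu.
pose v n := sval (near_min n).
have vC n : C n (v n) by have [] := svalP (near_min n).
have vd n : L2norm (v n) ^+ 2 < d n + e n by have [] := svalP (near_min n).
have dr n : d n <= r ^+ 2.
  apply: le_trans (dC _ _ (vC n)) _.
  have vr : L2norm (v n) <= r.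
    by apply: bounded; apply: le_trans (vC n); rewrite lee_fin lerD2l lerN2.
  by rewrite ler_pXn2r ?nnegrE ?L2norm_ge0// (le_trans _ vr)// L2norm_ge0.
have dmono n k : (n <= k)%N -> d n <= d k.
  move=> nk; apply: lb_le_inf; first by case: (Qinf k).
  by move=> _ [nu nuC <-]; apply: dC; exact: Csub nuC.
have dsup : has_sup (range d).
  by split; [exists (d 0%N), 0%N|exists (r ^+ 2) => _ [n _ <-]].
pose D := sup (range d).
have dD n : d n <= D by apply: ub_le_sup; [case: dsup|exists n].
(* The midpoint lies in [C n], so its squared norm is at least [d n]; the parallelogram law then
   leaves only the gap between [d n] and [D]. *)
have cauchy n k : (n <= k)%N -> L2norm (v k - v n) ^+ 2 <= 2 * (D - d n) + 4 * e n.
  move=> nk; rewrite L2_parallelogram.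
  have mid : C n (2^-1 *: v k + (1 - 2^-1) *: v n).
    have half : (0 < (2^-1 : R)) && ((2^-1 : R) < 1).
      by rewrite invr_gt0 ltr0n invf_lt1 ?ltr1n ?ltr0n.
    apply: le_trans (frakS_concave L_gt0 a u wbar (v k) (v n) half).
    have -> : (m - e n)%:E = (2^-1%:E * (m - e n)%:E + (1 - 2^-1)%:E * (m - e n)%:E)%E.
      by rewrite -!EFinM -EFinD; congr EFin; ring.
    apply: leeD; apply: lee_wpmul2l; rewrite ?lee_fin.
    - by case/andP: half => /ltW.
    - exact: Csub (vC k).
    - by case/andP: half => _ /ltW; rewrite subr_ge0.
    - exact: vC.
  have := dC _ _ mid; have := vd k; have := vd n; have := dD k; have := eD _ _ nk.
  move: (L2norm (v k) ^+ 2) (L2norm (v n) ^+ 2) (L2norm (_ + _) ^+ 2) => p q s.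
  move: (d n) (d k) (e n) (e k) (D) => dn dk en ek DD.
  by lra.
(* The factor 1/6 because [cauchy] will yield 2 eta + 4 eta. *)
pose eta k : R := 6^-1 * 8^-1 ^+ k.
have eta0 k : 0 < eta k by rewrite mulr_gt0// exprn_gt0.
have late k : {N : nat | forall n, (N <= n)%N -> D - d n <= eta k /\ e n <= eta k}.
  apply: cid; have [_ [n1 _ <-] dn1] := sup_adherent (eta0 k) dsup.
  pose n2 := Num.truncn (eta k)^-1.
  exists (maxn n1 n2) => n; rewrite geq_max => /andP[n1n n2n]; split.
    by have := dmono _ _ n1n; move: dn1; rewrite -/D; lra.
  rewrite /e invf_ple ?posrE//; apply: le_trans (ltW (truncnS_gt _)) _.
  by rewrite ler_nat ltnS.
(* Partial sums make the indices nondecreasing while keeping them past [late k]. *)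
pose N k := \sum_(j < k.+1) sval (late j).
have Nk k : (sval (late k) <= N k)%N by rewrite /N big_ord_recr leq_addl.
have Nmono k : (N k <= N k.+1)%N by rewrite /N [X in (_ <= X)%N]big_ord_recr leq_addr.
exists (v \o N) => k; have [dk ek] := svalP (late k) _ (Nk k); split => /=.
  apply: le_trans (vC (N k)); rewrite lee_fin lerD2l lerN2 (le_trans ek)// /eta.
  by rewrite ler_piMl ?exprn_ge0// invf_le1// ler1n.
apply: le_trans (cauchy _ _ (Nmono k)) _.
by move: dk ek; rewrite /eta; move: (8^-1 ^+ k) (d (N k)) (e (N k)) (D) => p q s t; lra.
Qed.

Lemma frakS_maximizer : coercive (\- S)%E -> exists nu, maximizer S nu.
Proof.
move=> coer; pose M := ereal_sup (range S).
have M0 : (M <= 0)%E by apply: ge_ereal_sup => _ [nu _ <-]; exact: frakS_le0.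
have SM nu : (S nu <= M)%E by apply: ereal_sup_ubound; exists nu.
have Mfin : M \is a fin_num.
  rewrite fin_numElt (lt_le_trans frakS0_gtNy (SM 0%R))/=.
  by apply: le_lt_trans M0 (ltry _).
pose m := fine M; have mM : m%:E = M by rewrite fineK.
have approach (e : R) : 0 < e -> exists nu, ((m - e)%:E <= S nu)%E.
  move=> e0; have : ((m - e)%:E < M)%E by rewrite -mM lte_fin ltrBlDr ltrDl.
  by move=> /ereal_sup_gt[_ [nu _ <-]] /ltW; exists nu.
(* Coercivity at the level 1 - m bounds the superlevel set of S at m - 1. *)
have [r rP] := coer (1 - m).
have bounded nu : ((m - 1)%:E <= S nu)%E -> L2norm nu <= r.
  move=> nuS; rewrite leNgt; apply/negP => /rP; rewrite ltNge => /negP; apply.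
  by rewrite leeNl -EFinN opprB.
have [f fP] := maximizing_sequence approach bounded.
have [nu [C nuC]] := L2_complete (fun n => (fP n).2).
exists nu => nu'; apply: le_trans (SM nu') _; rewrite -mM leNgt; apply/negP.
(* If S nu < m, some [w] witnesses it. A level [c] strictly between gives S < c in a neighbourhood
   of nu, while S is at least m - 8^-n along the sequence. *)
move=> /ereal_inf_lt[_ [w _ <-]]; rewrite (dual_integralE L_gt0) lte_fin.
set D := \int[_]_(_ in _) _ => Dm; pose c := (D + m) / 2.
have Dc : D < c by rewrite /c; lra.
have cm : c < m by rewrite /c; lra.
have : (S nu < c%:E)%E.
  apply: le_lt_trans (frakS_le L_gt0 a u wbar nu (L2_measurable w) (L2_sqint w)) _.
  by rewrite lte_fin.
move=> /(frakS_usc L_gt0)[V /nbhs_L2P[e e0 eV] Vc].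
have geo (z A b : R) : `|z| < 1 -> 0 < b -> \forall n \near \oo, A * z ^+ n < b.
  move=> z1 b0; have := @cvg_geometric R A z z1.
  by move=> /cvgr_lt; apply.
have z4 : `|4^-1 : R| < 1 by rewrite ger0_norm// invf_lt1// ltr1n.
have z8 : `|8^-1 : R| < 1 by rewrite ger0_norm// invf_lt1// ltr1n.
have e20 : 0 < e ^+ 2 by rewrite exprn_gt0.
have mc0 : 0 < m - c by rewrite subr_gt0.
have [n [n4 n8]] := filter_ex (filterI (geo _ C _ z4 e20) (geo _ 1 _ z8 mc0)).
have fV : V (f n).
  apply: eV; rewrite -(@ltr_pXn2r _ 2)// ?nnegrE ?L2norm_ge0 ?(ltW e0)//.
  exact: le_lt_trans (nuC n) n4.
have := Vc _ fV; rewrite ltNge => /negP; apply.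
apply: le_trans (fP n).1; rewrite lee_fin; move: n8; rewrite mul1r.
by move: (8^-1 ^+ n) => p; lra.
Qed.

End maximizer.

(** Testing with t = e G for small e > 0 gives e G^2 <= e^2 G^2 Q, which is impossible for G != 0
    once e Q < 1. *)
Lemma eq0_of_le_sqr (R : realFieldType) (G Q t0 : R) : 0 < t0 ->
  (forall t, `|t| <= t0 -> t * G <= t ^+ 2 * Q) -> G = 0.
Proof.
move=> t00 H; apply: contrapT => /eqP Gn0.
have G0 : 0 < `|G| by rewrite normr_gt0.
have den0 : 0 < `|G| + t0 * (`|Q| + 1) by rewrite addr_gt0// mulr_gt0// ltr_wpDl.
(* Small enough for both |e G| <= t0 and e |Q| < 1. *)
pose e := t0 / (`|G| + t0 * (`|Q| + 1)).
have e0 : 0 < e by rewrite divr_gt0.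
have eG : `|e * G| <= t0.
  rewrite normrM (gtr0_norm e0) /e mulrAC ler_pdivrMr// ler_pM2l// lerDl.
  by rewrite mulr_ge0 ?addr_ge0// ltW.
have eQ : e * Q < 1.
  apply: le_lt_trans (_ : e * `|Q| < 1).
    by rewrite ler_wpM2l ?ler_norm// ltW.
  rewrite /e mulrAC ltr_pdivrMr// mul1r mulrDr mulr1.
  by rewrite (lt_le_trans (_ : t0 * `|Q| < t0 * `|Q| + t0)) ?ltrDl// lerDr ltW.
have := H _ eG; rewrite leNgt => /negP; apply.
have -> : (e * G) ^+ 2 * Q = (e * G ^+ 2) * (e * Q) by ring.
have -> : e * G * G = (e * G ^+ 2) * 1 by ring.
by rewrite ltr_pM2l// mulr_gt0// exprn_even_gt0.
Qed.

(* Expand around w with z = f - w, where w A + B = 0, and complete the square in z. *)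
Lemma perturbed_density_ge (R : realFieldType) (A B k b t d w f : R) : 0 < d ->
  d / 2 <= A + t * k -> w * A + B = 0 ->
  (w ^+ 2 / 2 * A + w * B) + t * (2^-1 * (w ^+ 2 * k) + w * b)
    - t ^+ 2 * (d^-1 * (b + k * w) ^+ 2) <=
  f ^+ 2 / 2 * (A + t * k) + f * (B + t * b).
Proof.
move=> d0 dA wA; rewrite -subr_ge0.
have BE : B = - (w * A) by apply/eqP; rewrite -addr_eq0 addrC wA.
have -> : f ^+ 2 / 2 * (A + t * k) + f * (B + t * b) - (w ^+ 2 / 2 * A + w * B +
   t * (2^-1 * (w ^+ 2 * k) + w * b) - t ^+ 2 * (d^-1 * (b + k * w) ^+ 2)) =
   (f - w) ^+ 2 / 2 * (A + t * k - d / 2) +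
   d / 4 * ((f - w) + 2 * t * (b + k * w) / d) ^+ 2.
  by rewrite BE; field; rewrite gt_eqF.
by rewrite addr_ge0// mulr_ge0 ?divr_ge0 ?sqr_ge0 ?subr_ge0// ltW.
Qed.

(** * The Euler-Lagrange equation *)

Section iterated_derivatives.
Context {R : realType}.
Implicit Types f g : R -> R.

(** The function changes to its derivative as the order decreases, so inductions pass from f to f';
    [iter_derivable_smooth] returns to [derive1n]. *)
Fixpoint iter_derivable n f :=
  if n is m.+1 then (forall x, derivable f x 1) /\ iter_derivable m (derive1 f) else True.

Lemma iter_derivable_smooth f : (forall n, iter_derivable n f) -> smooth f.
Proof.
move=> H n; have := H n.+1; elim: n f {H} => [|n IH] f [fd fn] x; first exact: fd.
by rewrite derive1Sn; exact: IH.
Qed.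

Lemma iter_derivableS n f g : (forall x : R, is_derive x 1 f (g x)) ->
  iter_derivable n g -> iter_derivable n.+1 f.
Proof.
move=> fg gn; split; first by move=> x; have [] := fg x.
rewrite (_ : (derive1 f) = g)//; apply/funext => x.
by rewrite derive1E; exact: derive_val.
Qed.

Lemma iter_derivableW n f : iter_derivable n.+1 f -> iter_derivable n f.
Proof. by elim: n f => // n IH f [fd fn]; split => //; exact: IH. Qed.

Lemma is_derive_derive1 f x : derivable f x 1 -> is_derive x 1 f ((derive1 f) x).
Proof. by move=> fx; rewrite derive1E; exact: derivableP. Qed.

Lemma iter_derivable_cst n (c : R) : iter_derivable n (cst c).
Proof.
elim: n c => // n IH c; apply: (iter_derivableS (g := cst 0)) => //.
Qed.

Lemma iter_derivableD n f g : iter_derivable n f -> iter_derivable n g ->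
  iter_derivable n (fun x => f x + g x).
Proof.
elim: n f g => // n IH f g [fd fn] [gd gn].
apply: (iter_derivableS (g := fun x => (derive1 f) x + (derive1 g) x)); last exact: IH.
by move=> x; apply: is_deriveD; exact: is_derive_derive1.
Qed.

Lemma iter_derivableM n f g : iter_derivable n f -> iter_derivable n g ->
  iter_derivable n (fun x => f x * g x).
Proof.
elim: n f g => // n IH f g Df Dg; have [fd fn] := Df; have [gd gn] := Dg.
apply: (iter_derivableS (g := fun x => f x * (derive1 g) x + g x * (derive1 f) x)).
  by move=> x; apply: is_deriveM; exact: is_derive_derive1.
by apply: iter_derivableD; apply: IH => //; exact: iter_derivableW.
Qed.

Lemma iter_derivable_shift n s f : iter_derivable n f ->
  iter_derivable n (fun x => f (x + s)).
Proof.
elim: n f => // n IH f [fd fn].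
apply: (iter_derivableS (g := fun x => (derive1 f) (x + s))); last exact: IH.
move=> x; have fs := is_derive_derive1 (fd (x + s)).
have ds : is_derive x 1 (+%R^~ s : R -> R) 1.
  by rewrite -[X in is_derive _ _ _ X]addr0; apply: is_deriveD.
have := @is_derive1_comp _ f (+%R^~ s : R -> R) x _ _ fs ds.
by rewrite mulr1.
Qed.

End iterated_derivatives.

(** * First variation and regularity at a maximizer *)

Section euler_lagrange.
Context {R : realType} (L : \bar R) (L_gt0 : (0 < L)%E).
Variables (a u : R) (wbar : L2 L).
Local Notation mu := (@lebesgue_measure R).
Local Notation TR := (measurableTypeR R).
Local Notation mO := (measurable_Omega L).
Local Notation K := (Kop L).
Local Notation S := (frakS a u wbar).
Local Notation A := (Acoef a).
Local Notation B := (Bcoef a u wbar).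
Local Notation density := (density a u wbar).
Local Notation "'I' f" := (\int[mu]_(x in Omega L) f x) (at level 10, f at level 9).

Lemma Kop_ae f g (Z : set TR) : measurable_fun setT f -> measurable_fun setT g ->
  measurable Z -> mu Z = 0%E ->
  (forall x, ~ Z x -> periodic_ext L f x = periodic_ext L g x) -> forall x, K f x = K g x.
Proof.
move=> mf mg mZ Z0 fg x; rewrite /Kop /Rintegral; congr fine.
apply: ae_eq_integral.
- exact: measurable_itvR.
- by apply/measurable_EFinP/measurable_funTS; exact: measurable_periodic_ext.
- by apply/measurable_EFinP/measurable_funTS; exact: measurable_periodic_ext.
exists Z; split => // y /= fgy; apply: contrapT => /fg fgE; apply: fgy => _.
by rewrite fgE.
Qed.

Variable nu : L2 L.
Hypothesis nu_max : maximizer S nu.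
Variable d : R.
Hypothesis d_gt0 : 0 < d.
Hypothesis dA : forall x, d <= A nu x.

Local Notation W := (what a u wbar nu).
Let W2 x := W x ^+ 2.
Let mW : measurable_fun setT W := measurable_what L_gt0 a u wbar nu.
Let mW2 : measurable_fun setT W2.
Proof. exact: measurable_funX. Qed.

Let A_neq0 x : A nu x != 0.
Proof. by rewrite gt_eqF// (lt_le_trans d_gt0). Qed.

(** With A >= d the quotient is at most |B| / d in absolute value. *)
Lemma sqint_what : sqint mu (Omega L) W.
Proof.
apply: (le_sqint _ _ _ (sqintZ mO d^-1 (sqint_B L_gt0 a u wbar nu))).
- exact: mO.
- exact: measurable_funTS.
move=> x _; rewrite whatE !exprMn sqrrN mulrC ler_wpM2r ?sqr_ge0//.
rewrite ler_pXn2r ?nnegrE ?invr_ge0 ?(ltW d_gt0) ?(ltW (lt_le_trans d_gt0 (dA x)))//.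
by rewrite lef_pV2 ?posrE// (lt_le_trans d_gt0).
Qed.

Let sW := sqint_what.
Let iW2 : mu.-integrable (Omega L) (EFin \o W2). Proof. by case: sW. Qed.
Let LIW : locally_integrable_ext L W := sqint_locally_ext L_gt0 mW sW.
Let LIW2 : locally_integrable_ext L W2 := integrable_locally_ext L_gt0 mW2 iW2.

(** The bound of [perturbed_density_ge] holds for every test function, so once integrated it bounds
    S at nu + t h from below; maximality bounds S there by S nu, hence by the integral at [W]. What
    remains is t G <= t^2 Q for small t of either sign. *)
Lemma maximizer_stationary (h : L2 L) :
  I (fun x => 2^-1 * (W2 x * K h x) + W x * (h x + u * K h x)) = 0.
Proof.
have [C C0 KC] := Kop_bounded L_gt0.
pose b x := h x + u * K h x; pose q x := b x + K h x * W x.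
have sKh := L2_sqint_Kop L_gt0 h.
have mKh : measurable_fun (Omega L) (K h) by case: sKh.
have sb : sqint mu (Omega L) b by apply: sqintD (sqintZ _ _ _) => //; [exact: mO|exact: L2_sqint|exact: mO].
have sq : sqint mu (Omega L) q.
  apply: sqintD => //; first exact: mO.
  by apply: (sqintMb _ _ (M := C * L2norm h)) => //; exact: mO.
have [_ iq] := sq.
set g := fun x => _ + _.
have ig : mu.-integrable (Omega L) (EFin \o g).
  apply: (integrableDR mO); last exact: (sqint_mul mO sW sb).
  apply: (integrableZR mO); have := integrableMR mO mKh (fun x _ => KC h x) iW2.
  by under eq_fun do rewrite mulrC.
have iW := integrable_density L_gt0 a u wbar nu sW.
have n0 := L2norm_ge0 h; have Cn0 : 0 <= C * L2norm h by rewrite mulr_ge0// ltW.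
(* For |t| up to this threshold, |t K h| <= d / 2, so A stays at least d / 2 along the
   perturbation. *)
apply: (@eq0_of_le_sqr _ _ (d^-1 * I (fun x => q x ^+ 2)) (d / (2 * (C * L2norm h + 1)))).
  by rewrite divr_gt0// mulr_gt0// ltr_wpDl.
move=> t; rewrite ler_pdivlMr ?mulr_gt0 ?ltr_wpDl// => tC.
pose nut : L2 L := nu + t *: h.
have Knut x : K nut x = K nu x + t * K h x.
  by have := KopDZ L_gt0 nu h 1 t x; rewrite scale1r mul1r.
have Anut x : d / 2 <= A nu x + t * K h x.
  have := dA x; have : `|t * K h x| <= d / 2.
    rewrite normrM; apply: le_trans (ler_wpM2l (normr_ge0 t) (KC h x)) _.
    rewrite ler_pdivlMr// mulrAC -mulrA; apply: le_trans tC.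
    by rewrite ler_wpM2l// ler_pM2l// lerDl.
  by rewrite ler_norml => /andP[]; move: (t * _) (A nu x) => p r; lra.
have WAB x : W x * A nu x + B nu x = 0.
  by rewrite whatE divfK// addrC subrr.
have low : ((I (density nu W) + t * I g - t ^+ 2 * (d^-1 * I (fun x => q x ^+ 2)))%:E
    <= S nut)%E.
  apply: (frakS_ge L_gt0) => f; rewrite lee_fin.
  have iqd := integrableZR mO d^-1 iq.
  have it2 := integrableZR mO (- t ^+ 2) iqd.
  have itg := integrableZR mO t ig; have iWtg := integrableDR mO iW itg.
  rewrite -mulNr -(RintegralZl _ mO iq) -(RintegralZl _ mO iqd) -(RintegralZl t mO ig).
  rewrite -(RintegralD mO iW itg) -(RintegralD mO iWtg it2).
  apply: (le_Rintegral mO).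
  - exact: (integrableDR mO iWtg it2).
  - exact: (integrable_density L_gt0 a u wbar nut (L2_sqint f)).
  move=> x _.
  have := perturbed_density_ge (b x) (f x) d_gt0 (Anut x) (WAB x).
  rewrite mulNr /density /g /q.
  have -> : A nu x + t * K h x = A nut x by rewrite /Acoef Knut addrA.
  have -> // : B nu x + t * b x = B nut x.
  by rewrite /Bcoef Knut /nut L2valD L2valZ /b; ring.
have := le_trans low (le_trans (nu_max nut) (frakS_le L_gt0 a u wbar nu mW sW)).
by rewrite lee_fin; move: (I _) (I _) (_ * (_ * _)) => p r s; lra.
Qed.

Let F x := W x + u * K W x + 2^-1 * K W2 x.

(** Self-adjointness moves K off h. Test functions are bounded because W^2 is only known to be
    integrable, and [Kop_self_adjoint] has to pair it with h. *)
Lemma euler_lagrange_tested (h : L2 L) (M : R) : 0 <= M -> (forall x, `|h x| <= M) ->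
  mu.-integrable (Omega L) (EFin \o (fun x => h x * F x)) /\ I (fun x => h x * F x) = 0.
Proof.
move=> M0 hM; have sh := L2_sqint h; have [_ ih2] := sh.
have mh := L2_measurable h; have LIh := L2_LI L_gt0 h.
have [C C0 KC] := Kop_bounded L_gt0.
have sKh := L2_sqint_Kop L_gt0 h.
have mKh : measurable_fun (Omega L) (K h) by case: sKh.
have [i1 e1] : mu.-integrable (Omega L) (EFin \o (fun x => h x * K W x)) /\
    I (fun x => h x * K W x) = I (fun x => W x * K h x).
  apply: (@Kop_self_adjoint _ _ L_gt0 _ _ (fun x => h x ^+ 2) W2) => //.
  - exact: measurable_funX.
  - by move=> x; exact: sqr_ge0.
  - by move=> x; exact: sqr_ge0.
  - by move=> x y; exact: norm_mul_le_sqrD.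
have [i2 e2] : mu.-integrable (Omega L) (EFin \o (fun x => h x * K W2 x)) /\
    I (fun x => h x * K W2 x) = I (fun x => W2 x * K h x).
  apply: (@Kop_self_adjoint _ _ L_gt0 _ _ (cst 0) (fun x => M * W2 x)).
  - exact: measurable_cst.
  - by apply: measurable_funM => //; exact: measurable_cst.
  - by have := integrableZR mO 0 iW2; under eq_fun do rewrite mul0r.
  - exact: (integrableZR mO M iW2).
  - by move=> x; rewrite /cst.
  - by move=> x; rewrite mulr_ge0// sqr_ge0.
  - move=> x y; rewrite /cst add0r normrM (ger0_norm (sqr_ge0 (W y))).
    by rewrite ler_wpM2r ?sqr_ge0.
  - exact: LIh.
  - exact: LIW2.
have i3 := sqint_mul mO sh sW.
have i4 := sqint_mul mO sW sKh.
have i5 : mu.-integrable (Omega L) (EFin \o (fun x => W2 x * K h x)).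
  have := integrableMR mO mKh (fun x _ => KC h x) iW2.
  by under eq_fun do rewrite mulrC.
have j1 := integrableZR mO u i1; have j2 := integrableZR mO 2^-1 i2.
have j4 := integrableZR mO u i4; have j5 := integrableZR mO 2^-1 i5.
have hF : (fun x => h x * F x) =
    (fun x => h x * W x + u * (h x * K W x) + 2^-1 * (h x * K W2 x)).
  by apply/funext => x; rewrite /F; ring.
have j3 := integrableDR mO i3 j1; rewrite hF.
split; first exact: (integrableDR mO j3 j2).
have := maximizer_stationary h; rewrite (RintegralD mO j3 j2) (RintegralD mO i3 j1).
rewrite (RintegralZl _ mO i1) (RintegralZl _ mO i2) e1 e2 => H.
rewrite -[RHS]H.
have -> : I (fun x => 2^-1 * (W2 x * K h x) + W x * (h x + u * K h x)) =
    I (fun x => h x * W x + u * (W x * K h x) + 2^-1 * (W2 x * K h x)).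
  by apply: eq_Rintegral => x _; ring.
have j6 := integrableDR mO i3 j4.
rewrite (RintegralD mO j6 j5) (RintegralD mO i3 j4).
by rewrite (RintegralZl _ mO i4) (RintegralZl _ mO i5).
Qed.

Let mF : measurable_fun setT F.
Proof.
apply: measurable_funD; last by apply: measurable_funM => //; exact: measurable_Kop.
by apply: measurable_funD => //; apply: measurable_funM => //; exact: measurable_Kop.
Qed.

Lemma euler_lagrange_Omega : mu (Omega L `&` [set x | F x != 0]) = 0%E.
Proof.
have mF0 : measurable [set x : TR | F x != 0].
  rewrite (_ : [set _ | _] = F @^-1` (~` [set 0])).
    by apply: measurable_preimageT => //; exact: measurableC.
  by apply/seteqP; split => y /= /eqP.
have mE0 := measurableI _ _ mO mF0.
apply/eqP; rewrite eq_le measure_ge0 andbT leNgt; apply/negP.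
move=> /(positive_measure_bounded mE0)[m]; set E := (X in mu X) => E0.
have mE : measurable E by apply: measurableI => //; exact: measurable_itvR.
have EO : E `<=` Omega L by move=> x [[]].
(* Bounded by 1 and of the same sign as [F]: cut off to [E] it is an admissible test function whose
   product with [F] is positive there. *)
pose f x := F x / (1 + F x ^+ 2).
have den0 x : 0 < 1 + F x ^+ 2 by rewrite ltr_pwDl// sqr_ge0.
have f1 x : `|f x| <= 1.
  rewrite /f normrM normfV (gtr0_norm (den0 x)) ler_pdivrMr// mul1r.
  by rewrite -(real_normK (num_real (F x))); move: `|F x| => p; nra.
have mf : measurable_fun setT f.
  apply: measurable_funM => //; apply: (measurableT_comp (@measurable_invr R)).
  by apply: measurable_funD => //; exact: measurable_funX.
have mfE : measurable_fun setT (fun x : R => f x * \1_E x).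
  by apply: measurable_funM => //; exact: (measurable_indic mE).
have sfE : sqint mu (Omega L) (fun x => f x * \1_E x).
  by apply: (sqint_bounded (M := 1) (m := m%:R) mO mE) => // x [].
have [h hE] := L2_of_fun mfE sfE.
have h1 x : `|h x| <= 1.
  rewrite hE indicE; case: (x \in E); first by rewrite mulr1.
  by rewrite mulr0 normr0.
have [ihF hF0] := euler_lagrange_tested ler01 h1.
have hFE : (fun x => h x * F x) = (fun x => (f x * F x) * \1_E x).
  by apply/funext => x; rewrite hE mulrAC.
move: hF0; rewrite hFE (Rintegral_indic mu _ mO EO); apply/eqP; rewrite gt_eqF//.
apply: Rintegral_gt0 => //.
  move: ihF; rewrite hFE => /(integrableS mO mE EO); apply: eq_integrable => // x xE /=.
  by rewrite indicE xE mulr1.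
move=> x [[_ /= Fx] _]; rewrite /f mulrAC -expr2 divr_gt0//.
by rewrite exprn_even_gt0.
Qed.

Lemma maximizer_solution : exists w : R -> R,
  [/\ w = periodic_ext L W %[ae mu],
      forall r : R, L = r%:E -> periodic w (2 * r),
      smooth w
    & forall x : R, w x + u * K w x + 2^-1 * K (fun y => w y ^+ 2) x = 0].
Proof.
(* The equation solved for its first term: continuous and periodic by construction, whereas [W]
   satisfies it only almost everywhere. *)
pose w x := - (u * K W x + 2^-1 * K W2 x).
have cw : continuous w.
  move=> x; apply: cvgN; apply: cvgD; apply: cvgMr; exact: Kop_continuous.
have pw : Lperiodic L w.
  by move=> r Lr x; rewrite /w !(Lperiodic_Kop L_gt0 _ Lr).
have mw : measurable_fun setT w by exact: continuous_measurable_fun.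
have wK : forall y, periodic_ext L w y = w y by move=> y; exact: periodic_ext_id.
pose Z : set TR := [set x | periodic_ext L w x - periodic_ext L W x != 0].
have mZ : measurable Z.
  rewrite (_ : Z = (fun x => periodic_ext L w x - periodic_ext L W x) @^-1` (~` [set 0])).
    apply: measurable_preimageT; last exact: measurableC.
    by apply: measurable_funB; exact: measurable_periodic_ext.
  by apply/seteqP; split => y /= /eqP.
have Z0 : mu Z = 0%E.
  apply: (periodic_null L_gt0 mZ).
    by move=> r Lr x; rewrite /Z /= !(Lperiodic_ext L_gt0 _ Lr).
  rewrite -euler_lagrange_Omega; congr (mu _); apply/seteqP; split => x [Ox];
    rewrite /Z /= !(periodic_ext_Omega L_gt0)// => Fx; split => //=; move: Fx;
    by rewrite /F /w -oppr_eq0; congr (_ != _); ring.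
have extE x : ~ Z x -> periodic_ext L w x = periodic_ext L W x.
  by rewrite /Z /= => /negP; rewrite negbK subr_eq0 => /eqP.
have KW x : K w x = K W x by exact: (Kop_ae mw mW mZ Z0).
have KW2 x : K (fun y => w y ^+ 2) x = K W2 x.
  apply: (Kop_ae _ mW2 mZ Z0); first exact: measurable_funX.
  move=> y /extE; rewrite (periodic_extE L w) (periodic_extE L W) => wE.
  by rewrite (periodic_extE L W2) (periodic_extE L (fun y => w y ^+ 2)) wE.
have weq x : w x + u * K w x + 2^-1 * K (fun y => w y ^+ 2) x = 0.
  by rewrite KW KW2 /w; ring.
exists w; split => //.
- exists Z; split => // x /= wx; apply: contrapT => /extE wE.
  by apply: wx => _; rewrite -wE wK.
(* Bootstrap: w is a combination of K w and K(w^2), whose derivatives involve only translates of w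
   and w^2, so n derivatives of w give n + 1. *)
apply: iter_derivable_smooth; elim=> // n IH.
pose w' x := - u * (w (x + 1) + -1 * w (x + -1)) +
  - 2^-1 * (w (x + 1) * w (x + 1) + -1 * (w (x + -1) * w (x + -1))).
apply: (iter_derivableS (g := w')).
  move=> x.
  have cw2 : continuous (fun y => w y ^+ 2) by move=> y; exact: cvgM (cw y) (cw y).
  have pw2 : Lperiodic L (fun y => w y ^+ 2) by move=> r Lr y; rewrite (pw _ Lr).
  have -> : w = (- u *: (K w : R -> R)) + (- 2^-1 *: (K (fun y => w y ^+ 2) : R -> R)).
    apply/funext => y; change (w y = - u * K w y + - 2^-1 * K (fun y => w y ^+ 2) y).
    by move: (weq y); move: (w y) (K w y) (K _ y) => p q r; lra.
  have d1 := is_deriveZ (- u) (is_derive_Kop x cw pw).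
  have d2 := is_deriveZ (- 2^-1) (is_derive_Kop x cw2 pw2).
  apply: is_derive_eq (is_deriveD d1 d2) _.
  by rewrite /w' /GRing.scale/=; ring.
have sh s : iter_derivable n (fun x => w (x + s)) by exact: iter_derivable_shift.
have cM (c : R) (f : R -> R) : iter_derivable n f -> iter_derivable n (fun x => c * f x).
  by move=> fn; apply: (iter_derivableM (f := cst c)) => //; exact: iter_derivable_cst.
rewrite /w'; apply: iter_derivableD; apply: (cM); apply: iter_derivableD => //.
- exact: cM.
- exact: iter_derivableM.
- by apply: cM; exact: iter_derivableM.
Qed.

End euler_lagrange.

Theorem proposition3p2 (R : realType) (L : \bar R) (L_gt0 : (0 < L)%E)
    (a : R) (a_gt0 : 0 < a) (u : R) (wbar : L2 L) :
  [/\ (* (1) *)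
      [/\ forall nu : L2 L,
            lebesgue_measure (Nset a nu) = 0%E ->
            lebesgue_measure (Zset a u wbar nu) = 0%E ->
            frakS a u wbar nu =
              (\int[lebesgue_measure]_(x in Omega L)
                (- (2^-1 * (a + Kop L nu x) * what a u wbar nu x ^+ 2))%:E)%E,
          forall nu : L2 L,
            (0 < lebesgue_measure (Nset a nu))%E \/
              (0 < lebesgue_measure (Zset a u wbar nu))%E ->
            frakS a u wbar nu = -oo%E
        & forall nu : L2 L, (frakS a u wbar nu <= 0)%E],
      (* (2) *)
      concave (frakS a u wbar) /\ upper_semicontinuous (frakS a u wbar),
      (* (3) *)
      (dom (frakS a u wbar))^° = [set nu : L2 L | forall x : R, 0 < a + Kop L nu x],
      (* (4) *)
      coercive (\- frakS a u wbar)%E ->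
        exists nu : L2 L, maximizer (frakS a u wbar) nu
    & (* (5) *)
      forall nu : L2 L, maximizer (frakS a u wbar) nu ->
        (dom (frakS a u wbar))^° nu ->
        exists w : R -> R,
          [/\ w = periodic_ext L (what a u wbar nu) %[ae lebesgue_measure],
              forall r : R, L = r%:E -> periodic w (2 * r),
              smooth w
            & forall x : R,
                w x + u * Kop L w x + 2^-1 * Kop L (fun y => w y ^+ 2) x = 0]].
Proof.
split.
- split.
  + by move=> nu; exact: frakS_formula.
  + by move=> nu [|]; [exact: frakS_Nset|exact: frakS_Zset].
  + exact: frakS_le0.
- by split; [exact: frakS_concave|exact: frakS_usc].
- exact: frakS_interior.
- exact: frakS_maximizer.
move=> nu nu_max; rewrite frakS_interior// => nuA.
(* The interior gives pointwise positivity; the first variation needs a uniform lower bound. *)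
have [d d0 dA] := A_uniformly_positive L_gt0 a_gt0 nuA.
exact: (maximizer_solution L_gt0 nu_max d0 dA).
Qed.
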